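(* Let $B$ be a compact connected Riemann surface with function field $K=\mathbb{C}(B)$, let $S\subset B$ be a finite subset, let $U\subset B$ be a finite disjoint union of closed discs centered at the points of $S$, let $V\subset B\setminus U$ be a finite disjoint union of closed discs, and let $B_0=B\setminus(U\cup V)$. Let $n\ge1$ and $r\ge0$ be integers and let $\varepsilon>0$ be a real number. Then there are only finitely many $x\in\mathcal{O}_S^*(B_0,\varepsilon)$ modulo $\mathbb{C}^*$ for which the equation $$x+y=z$$ admits a solution with $y\in K^*$, $y^{-1}\in\mathcal{O}_{B_0,r}$ and $z\in L(nD_S)\setminus\{0\}$.
   Context: For a subset $R\subset B$, $\mathcal{O}_R=\{x\in K\colon\mathrm{val}_\nu(x)\ge0\text{ for all }\nu\in B\setminus R\}$; $\mathcal{O}_S^*$ is the group of units of $\mathcal{O}_S$, which contains the nonzero constants $\mathbb{C}^*$; ''modulo $\mathbb{C}^*$'' refers to classes in $\mathcal{O}_S^*/\mathbb{C}^*$. $\mathcal{O}_S^*(B_0,\varepsilon):=\{x\in\mathcal{O}_S^*\colon |x(t)|>\varepsilon\text{ and }|x(t)^{-1}|>\varepsilon\ \text{for all }t\in B_0\}$. $\mathcal{O}_{B_0,r}:=\bigcup_{R\subset B_0,\ \#R\le r}\{x\in K\colon \mathrm{val}_\nu(x)\ge0\text{ for every }\nu\notin R\cup(B\setminus B_0)\}$, i.e. the set of $x\in K$ having at most $r$ distinct poles in $B_0$. $D_S=\sum_{b\in S}[b]$ is the reduced effective divisor of $B$ supported on $S$, and $L(nD_S)\setminus\{0\}=\{h\in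 K^*\colon \mathrm{div}(h)+nD_S\ge0\}$. Discs in Riemann surfaces are assumed to have piecewise smooth boundary. *)

(* Defs.v *)
Set Warnings "-notation-overridden,-ambiguous-paths,-notation-incompatible-prefix,-redundant-canonical-projection".
From HB Require Import structures.
From mathcomp Require Import all_boot all_order all_algebra.
From mathcomp Require Import all_classical all_reals all_analysis.
From mathcomp Require Import complex.

Set Implicit Arguments.
Unset Strict Implicit.
Unset Printing Implicit Defensive.

Import Order.TTheory GRing.Theory Num.Theory numFieldNormedType.Exports.
Local Open Scope classical_set_scope.
Local Open Scope ring_scope.

(* [R[i]] itself carries no topology; seen as a [numFieldType], it inherits
   the one given by the modulus. *)
Definition C (R : realType) : numFieldType := R[i]%C.

Definition holomorphic_at (R : realType) (h : C R -> C R) (a : C R) : Prop :=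
  \forall w \near a, derivable h w 1.

Record chart (R : realType) (B : topologicalType) := Chart {
  chart_dom : set B;
  chart_map :> B -> C R;
  chart_inv : C R -> B;
  open_chart_dom : open chart_dom;
  open_chart_img : open (chart_map @` chart_dom);
  chart_mapK : forall p, chart_dom p -> chart_inv (chart_map p) = p;
  chart_continuous : forall p, chart_dom p -> {for p, continuous chart_map};
  chart_inv_continuous : forall p, chart_dom p ->
    {for chart_map p, continuous chart_inv} }.

(* No countability axiom: on a compact (indeed, by Rado, on any connected)
   Riemann surface it is automatic. *)
Record riemannSurface (R : realType) := RiemannSurface {
  rs_space :> topologicalType;
  rs_nonempty : [set: rs_space] !=set0;
  rs_hausdorff : hausdorff_space rs_space;
  rs_connected : connected [set: rs_space];
  atlas : set (chart R rs_space);
  atlas_cover : forall p, exists2 c, atlas c & chart_dom c p;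
  atlas_holomorphic : forall c1 c2, atlas c1 -> atlas c2 ->
    forall p, chart_dom c1 p -> chart_dom c2 p ->
      derivable (fun w => c2 (chart_inv c1 w)) (c1 p) 1 }.

Lemma mulf_divX (F : fieldType) (a b u : F) n m :
  a / u ^+ n * (b / u ^+ m) = a * b / u ^+ (n + m).
Proof. by rewrite mulf_div exprD. Qed.

Lemma addf_divX (F : fieldType) (a b u : F) n m : u != 0 ->
  a / u ^+ n + b / u ^+ m = (a * u ^+ m + b * u ^+ n) / u ^+ (n + m).
Proof. by move=> u0; rewrite addf_div ?exprD// expf_neq0. Qed.

Section FunctionField.
Context {R : realType} {B : riemannSurface R}.
Implicit Types (f g : B -> C R) (p q : B) (c : chart R B).

Definition meromorphic f : Prop := forall p c, atlas c -> chart_dom c p ->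
  exists (n : nat) (h : C R -> C R), holomorphic_at h (c p) /\
    \forall w \near (c p)^', f (chart_inv c w) = h w / (w - c p) ^+ n.

(* Values are filled in by continuity where possible; at the remaining points
   (the poles, if [f] is meromorphic) the value is 0 by convention. *)
Definition normalize f : B -> C R := fun p =>
  if `[< cvg (f q @[q --> p^']) >] then lim (f q @[q --> p^']) else 0.

Definition germ_eq f g : Prop := forall p, \forall q \near p^', f q = g q.

Lemma near_chart c p (P : B -> Prop) : chart_dom c p ->
  (\forall q \near p^', P q) <-> (\forall w \near (c p)^', P (chart_inv c w)).
Proof.
move=> cp; rewrite !near_withinE; split => H.
- have ci := chart_inv_continuous cp.
  have oi : nbhs (c p) (c @` chart_dom c).
    by apply: open_nbhs_nbhs; split; [exact: open_chart_img|exists p].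
  have H' : \forall q \near chart_inv c (c p), q != p -> P q.
    by rewrite chart_mapK.
  have {}H' := ci _ H'.
  rewrite !near_simpl in H' *; near=> w.
  have : (c @` chart_dom c) w by near: w.
  move=> [q cq qw]; rewrite -qw chart_mapK// => qp.
  have : chart_inv c w != p -> P (chart_inv c w) by near: w.
  rewrite -qw chart_mapK//; apply.
  by apply: contra_neq qp => ->.
- have cc := chart_continuous cp.
  have od : nbhs p (chart_dom c).
    by apply: open_nbhs_nbhs; split => //; exact: open_chart_dom.
  have {}H := cc _ H.
  rewrite !near_simpl in H *; near=> q => qp.
  have cq : chart_dom c q by near: q.
  have : c q != c p -> P (chart_inv c (c q)) by near: q.
  rewrite chart_mapK//; apply.
  by apply: contra_neq qp => /(congr1 (chart_inv c)); rewrite !chart_mapK.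
Unshelve. all: by end_near. Qed.

Lemma rs_dnbhs_proper p : ProperFilter p^'.
Proof.
split; last exact: dnbhs_filter.
have [c _ cp] := atlas_cover p.
move=> H; have /(near_chart _ cp) : \forall q \near p^', False by [].
by move=> /filter_ex[].
Qed.

Lemma germ_eq_sym f g : germ_eq f g -> germ_eq g f.
Proof. by move=> fg p; apply: filterS (fg p). Qed.

Lemma germ_eq_trans f g (h : B -> C R) :
  germ_eq f g -> germ_eq g h -> germ_eq f h.
Proof.
by move=> fg gh p; apply: filterS2 (fg p) (gh p) => q -> ->.
Qed.

Lemma germ_eq_op2 (op : C R -> C R -> C R) f f' g g' :
  germ_eq f f' -> germ_eq g g' ->
  germ_eq (fun q => op (f q) (g q)) (fun q => op (f' q) (g' q)).
Proof.
by move=> ff gg p; apply: filterS2 (ff p) (gg p) => q -> ->.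
Qed.

Lemma normalize_germ f g : germ_eq f g -> normalize f = normalize g.
Proof.
move=> fg; apply/funext => p.
have E : f q @[q --> p^'] = g q @[q --> p^'].
  apply/seteqP; split => A /= HA.
    by apply: filterS2 (fg p) HA => q /= ->.
  by apply: filterS2 (fg p) HA => q /= ->.
by rewrite /normalize E.
Qed.

Lemma meromorphic_germ f g : germ_eq f g -> meromorphic f -> meromorphic g.
Proof.
move=> fg mf p c ac cp; have [n [h [hh fh]]] := mf p c ac cp.
exists n, h; split => //.
by apply: filterS2 ((near_chart _ cp).1 (fg p)) fh => w ->.
Qed.

Lemma cvg_exprn (a w : C R) n : (v - a) ^+ n @[v --> w] --> (w - a) ^+ n.
Proof.
elim: n => [|n IH].
  have -> : (fun v : C R => (v - a) ^+ 0) = cst 1 by apply/funext => v; rewrite expr0.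
  rewrite expr0; exact: (@cvg_cst _ _ _ (nbhs w)).
have -> : (fun v : C R => (v - a) ^+ n.+1) = (fun v => (v - a) * (v - a) ^+ n).
  by apply/funext => v; rewrite exprS.
rewrite (exprS (w - a) n).
apply: (@cvgM (C R) _ (nbhs w) _ (fun v => v - a) (fun v => (v - a) ^+ n)); last exact: IH.
apply: (@cvgB _ _ _ (nbhs w)); first exact: cvg_id.
exact: (@cvg_cst _ _ _ (nbhs w)).
Qed.

Lemma cvg_quot (h : C R -> C R) (a w : C R) n : w != a ->
  h v @[v --> w] --> h w ->
  h v / (v - a) ^+ n @[v --> w] --> h w / (w - a) ^+ n.
Proof.
move=> wa hw.
have nz : (w - a) ^+ n != 0 by rewrite expf_neq0// subr_eq0.
exact: cvgM hw (cvgV nz (@cvg_exprn a w n)).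
Qed.

(* A meromorphic function is continuous on a punctured neighbourhood of
   each point. *)
Lemma normalize_id f : meromorphic f -> germ_eq (normalize f) f.
Proof.
move=> mf p; have [c ac cp] := atlas_cover p.
have [n [h [hh fh]]] := mf p c ac cp.
rewrite near_chart; last exact: cp.
have oi : \forall w \near c p, (c @` chart_dom c) w.
  by apply: open_nbhs_nbhs; split; [exact: open_chart_img|exists p].
have h1 : \forall w \near c p, \forall v \near w, derivable h v 1.
  exact: near_join hh.
have f1 : \forall w \near c p, \forall v \near w,
    v != c p -> f (chart_inv c v) = h v / (v - c p) ^+ n.
  by apply: near_join; move: fh; rewrite near_withinE.
rewrite near_withinE; near=> w => wp.
have [q cq qw] : (c @` chart_dom c) w by near: w.
rewrite -qw chart_mapK//.
suff fq : f x @[x --> q^'] --> f q.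
  rewrite /normalize; case: ifPn => [_|/asboolP[]]; last by apply/cvg_ex; exists (f q).
  apply: (@cvg_lim _ _ _ _ (rs_dnbhs_proper q) f) => //; exact: norm_hausdorff.
have H1 : \forall v \near w, v != c p -> f (chart_inv c v) = h v / (v - c p) ^+ n.
  by near: w.
have -> : f q = h w / (w - c p) ^+ n.
  by rewrite -(nbhs_singleton H1)// -qw chart_mapK.
have dh : derivable h w 1.
  by apply: (@nbhs_singleton _ w (fun v => derivable h v 1)); near: w.
have cont : h v / (v - c p) ^+ n @[v --> w] --> h w / (w - c p) ^+ n.
  have ch : h v @[v --> w] --> h w.
    by apply: differentiable_continuous; apply/derivable1_diffP.
  exact: cvg_quot.
have wn : \forall v \near w, v != c p.
  apply: (@open_nbhs_nbhs _ w [set v | v != c p]); split => //.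
  have -> : [set v | v != c p] = ~` [set c p].
    by apply/seteqP; split => v /= /eqP.
  by apply/closed_openC/accessible_closed_set1/hausdorff_accessible/norm_hausdorff.
suff : f x @[x --> q] --> h w / (w - c p) ^+ n.
  exact: cvg_within_filter.
have cqq := chart_continuous cq.
have : h (c x) / (c x - c p) ^+ n @[x --> q] --> h w / (w - c p) ^+ n.
  have cqw : c x @[x --> q] --> w by rewrite -qw; exact: cqq.
  exact: cvg_comp cqw cont.
apply: cvg_trans; apply: near_eq_cvg.
have od : nbhs q (chart_dom c).
  by apply: open_nbhs_nbhs; split => //; exact: open_chart_dom.
have H2 : \forall x \near q, c x != c p ->
    f (chart_inv c (c x)) = h (c x) / (c x - c p) ^+ n.
  by move: H1; rewrite -qw => /cqq.
have H3 : \forall x \near q, c x != c p by move: wn; rewrite -qw => /cqq.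
near=> x; have cx : chart_dom c x by near: x.
have : c x != c p -> f (chart_inv c (c x)) = h (c x) / (c x - c p) ^+ n.
  by near: x.
by rewrite chart_mapK// => <-//; near: x.
Unshelve. all: by end_near. Qed.

Lemma holomorphic_atX (a b : C R) n :
  holomorphic_at (fun w => (w - b) ^+ n) a.
Proof.
rewrite /holomorphic_at; near=> w; elim: n => [|n IH].
  have -> : (fun v : C R => (v - b) ^+ 0) = cst 1 by apply/funext => v; rewrite expr0.
  exact: derivable_cst.
have -> : (fun v : C R => (v - b) ^+ n.+1) = (fun v => v - b) * (fun v => (v - b) ^+ n).
  by apply/funext => v; rewrite exprS.
have db : derivable (fun v : C R => v - b) w 1.
  by apply: (@derivableB _ _ _ id (cst b)); [exact: derivable_id|exact: derivable_cst].
exact: derivableM db IH.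
Unshelve. all: by end_near. Qed.

Lemma holomorphic_atD (h k : C R -> C R) a : holomorphic_at h a ->
  holomorphic_at k a -> holomorphic_at (fun w => h w + k w) a.
Proof. by apply: filterS2 => w hw kw; exact: derivableD. Qed.

Lemma holomorphic_atM (h k : C R -> C R) a : holomorphic_at h a ->
  holomorphic_at k a -> holomorphic_at (fun w => h w * k w) a.
Proof. by apply: filterS2 => w hw kw; exact: derivableM. Qed.

Lemma meromorphic_cst (z : C R) : meromorphic (fun=> z).
Proof.
move=> p c _ _; exists 0%N, (fun=> z); split.
  by rewrite /holomorphic_at; near=> w; exact: derivable_cst.
by near=> w; rewrite expr0 divr1.
Unshelve. all: by end_near. Qed.

Lemma meromorphicM f g :
  meromorphic f -> meromorphic g -> meromorphic (fun q => f q * g q).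
Proof.
move=> mf mg p c ac cp; have [n [h [hh fh]]] := mf p c ac cp.
have [m [k [hk gk]]] := mg p c ac cp.
exists (n + m)%N, (fun w => h w * k w); split.
  exact: holomorphic_atM.
near=> w.
have fw : f (chart_inv c w) = h w / (w - c p) ^+ n by near: w; exact: fh.
have gw : g (chart_inv c w) = k w / (w - c p) ^+ m by near: w; exact: gk.
rewrite fw gw.
apply: mulf_divX.
Unshelve. all: by end_near. Qed.

Lemma meromorphicD f g :
  meromorphic f -> meromorphic g -> meromorphic (fun q => f q + g q).
Proof.
move=> mf mg p c ac cp; have [n [h [hh fh]]] := mf p c ac cp.
have [m [k [hk gk]]] := mg p c ac cp.
exists (n + m)%N, (fun w => h w * (w - c p) ^+ m + k w * (w - c p) ^+ n); split.
  have X := holomorphic_atX (c p) (c p).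
  apply: (holomorphic_atD (holomorphic_atM hh (X m)) (holomorphic_atM hk (X n))).
near=> w.
have fw : f (chart_inv c w) = h w / (w - c p) ^+ n by near: w; exact: fh.
have gw : g (chart_inv c w) = k w / (w - c p) ^+ m by near: w; exact: gk.
rewrite fw gw.
apply: addf_divX; rewrite subr_eq0; near: w; exact: nbhs_dnbhs_neq.
Unshelve. all: by end_near. Qed.

Lemma meromorphicN f : meromorphic f -> meromorphic (fun q => - f q).
Proof.
move=> mf; have := meromorphicM (meromorphic_cst (-1)) mf.
apply: meromorphic_germ => p; near=> q; apply: mulN1r.
Unshelve. all: by end_near. Qed.

Lemma meromorphic_normalize f : meromorphic f -> meromorphic (normalize f).
Proof.
move=> mf; apply: (meromorphic_germ _ mf).
by apply: germ_eq_sym; exact: normalize_id.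
Qed.

Lemma normalizeK f : meromorphic f -> normalize (normalize f) = normalize f.
Proof. by move=> mf; apply: normalize_germ; exact: normalize_id. Qed.

End FunctionField.

(* A meromorphic function, as an element of the function field, is represented
   by its normalized function: two meromorphic functions which agree off a
   discrete set are the same element. *)
Record functionField (R : realType) (B : riemannSurface R) := FunctionField {
  ff_val :> B -> C R;
  ff_meromorphic : meromorphic ff_val;
  ff_normal : normalize ff_val = ff_val }.

HB.instance Definition _ (R : realType) (B : riemannSurface R) :=
  gen_eqMixin (functionField B).
HB.instance Definition _ (R : realType) (B : riemannSurface R) :=
  gen_choiceMixin (functionField B).

Section FunctionFieldRing.
Context {R : realType} {B : riemannSurface R}.
Local Notation K := (functionField B).
Implicit Types x y z : K.

Definition ff_of (f : B -> C R) (mf : meromorphic f) : K :=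
  FunctionField (meromorphic_normalize mf) (normalizeK mf).

Definition ff_const (a : C R) : K := ff_of (meromorphic_cst a).
Definition ff_opp x : K := ff_of (meromorphicN (ff_meromorphic x)).
Definition ff_add x y : K :=
  ff_of (meromorphicD (ff_meromorphic x) (ff_meromorphic y)).
Definition ff_mul x y : K :=
  ff_of (meromorphicM (ff_meromorphic x) (ff_meromorphic y)).

Lemma ff_ext x y : germ_eq x y -> x = y.
Proof.
case: x y => [f mf nf] [g mg ng] /= /normalize_germ; rewrite nf ng => fg.
by subst g; congr FunctionField; exact: Prop_irrelevance.
Qed.

Lemma ff_ofE (f : B -> C R) (mf : meromorphic f) : germ_eq (ff_of mf) f.
Proof. exact: normalize_id. Qed.

Lemma ff_addE x y : germ_eq (ff_add x y) (fun q => x q + y q).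
Proof. exact: ff_ofE. Qed.

Lemma ff_mulE x y : germ_eq (ff_mul x y) (fun q => x q * y q).
Proof. exact: ff_ofE. Qed.

Lemma ff_addA : associative ff_add.
Proof.
move=> x y z; apply: ff_ext => p.
apply: filterS3 (filterI (ff_addE x (ff_add y z) p) (ff_addE y z p))
  (ff_addE (ff_add x y) z p) (ff_addE x y p) => q [-> ->] -> ->.
by rewrite addrA.
Qed.

Lemma ff_addC : commutative ff_add.
Proof.
move=> x y; apply: ff_ext => p.
by apply: filterS2 (ff_addE x y p) (ff_addE y x p) => q -> ->; rewrite addrC.
Qed.

Lemma ff_add0 : left_id (ff_const 0) ff_add.
Proof.
move=> x; apply: ff_ext => p.
apply: filterS2 (ff_addE (ff_const 0) x p) (ff_ofE (meromorphic_cst 0) p).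
by move=> q -> ->; rewrite add0r.
Qed.

Lemma ff_addN : left_inverse (ff_const 0) ff_opp ff_add.
Proof.
move=> x; apply: ff_ext => p.
apply: filterS3 (ff_addE (ff_opp x) x p) (ff_ofE (meromorphic_cst 0) p)
  (ff_ofE (meromorphicN (ff_meromorphic x)) p) => q -> -> ->.
by rewrite addNr.
Qed.

Lemma ff_mulA : associative ff_mul.
Proof.
move=> x y z; apply: ff_ext => p.
apply: filterS3 (filterI (ff_mulE x (ff_mul y z) p) (ff_mulE y z p))
  (ff_mulE (ff_mul x y) z p) (ff_mulE x y p) => q [-> ->] -> ->.
by rewrite mulrA.
Qed.

Lemma ff_mulC : commutative ff_mul.
Proof.
move=> x y; apply: ff_ext => p.
by apply: filterS2 (ff_mulE x y p) (ff_mulE y x p) => q -> ->; rewrite mulrC.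
Qed.

Lemma ff_mul1 : left_id (ff_const 1) ff_mul.
Proof.
move=> x; apply: ff_ext => p.
apply: filterS2 (ff_mulE (ff_const 1) x p) (ff_ofE (meromorphic_cst 1) p).
by move=> q -> ->; rewrite mul1r.
Qed.

Lemma ff_mulD : left_distributive ff_mul ff_add.
Proof.
move=> x y z; apply: ff_ext => p.
apply: filterS3 (filterI (ff_mulE (ff_add x y) z p) (ff_addE x y p))
  (ff_addE (ff_mul x z) (ff_mul y z) p)
  (filterI (ff_mulE x z p) (ff_mulE y z p)) => q [-> ->] -> [-> ->].
by rewrite mulrDl.
Qed.

Lemma ff_oner_neq0 : ff_const 1 != ff_const 0.
Proof.
apply/eqP => e; have [p _] := rs_nonempty B.
have /(@filter_ex _ _ (rs_dnbhs_proper p))[q] : \forall q \near p^', (1 : C R) = 0.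
  apply: filterS2 (ff_ofE (meromorphic_cst 1) p) (ff_ofE (meromorphic_cst 0) p).
  by move=> q <- <-; rewrite -/(ff_const 1) e.
by move=> /eqP; rewrite oner_eq0.
Qed.

HB.instance Definition _ := GRing.isZmodule.Build K
  ff_addA ff_addC ff_add0 ff_addN.
HB.instance Definition _ := GRing.Zmodule_isComNzRing.Build K
  ff_mulA ff_mulC ff_mul1 ff_mulD ff_oner_neq0.

(* Every nonzero element is invertible, by the identity theorem; the inverse is
   chosen here so that no complex analysis is needed to define it. *)
Definition ff_unit : pred K := fun x => `[< exists y, y * x = 1 >].
Definition ff_inv x : K := if ff_unit x then xget 0 [set y | y * x = 1] else x.

Lemma ff_mulV : {in ff_unit, left_inverse 1 ff_inv *%R}.
Proof.
move=> x xu; rewrite /ff_inv ifT//; move: xu => /asboolP[y yx].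
by apply: (@xgetPex _ 0 [set y | y * x = 1]); exists y.
Qed.

Lemma ff_unitP x y : y * x = 1 -> ff_unit x.
Proof. by move=> yx; apply/asboolP; exists y. Qed.

Lemma ff_invr_out : {in [predC ff_unit], ff_inv =1 id}.
Proof. by move=> x /negbTE xu; rewrite /ff_inv; move: xu; rewrite /in_mem/= => ->. Qed.

HB.instance Definition _ := GRing.ComNzRing_hasMulInverse.Build K
  ff_mulV ff_unitP ff_invr_out.

End FunctionFieldRing.

Section Valuation.
Context {R : realType} {B : riemannSurface R}.
Local Notation K := (functionField B).
Implicit Types (x h : K) (p : B).

Definition has_order p x (m : int) : Prop :=
  forall c, atlas c -> chart_dom c p ->
    exists h : C R -> C R, [/\ holomorphic_at h (c p), h (c p) != 0 &
      \forall w \near (c p)^', x (chart_inv c w) = (w - c p) ^ m * h w].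

(* For [x != 0] the order exists and is unique, so [xget] picks it. *)
Definition val p x : \bar int :=
  if x == 0 then +oo%E else (xget 0 [set m | has_order p x m])%:E%E.

Definition regular_off (A : set B) : set K :=
  [set x | forall p, ~ A p -> (0 <= val p x)%E].

Definition regular_units (A : set B) : set K :=
  [set x | regular_off A x /\ exists2 x', regular_off A x' & x * x' = 1].

(* When [B0] is disjoint from [S], neither [x] nor [x^-1] is evaluated at a
   pole here. *)
Definition bounded_units (S B0 : set B) (eps : R) : set K :=
  [set x | regular_units S x /\ forall t, B0 t ->
    (eps%:C)%C < `|x t| /\ (eps%:C)%C < `|(x^-1) t| ].

Definition few_poles (B0 : set B) (r : nat) : set K :=
  [set x | exists A : set B,
    [/\ A `<=` B0, (A #<= `I_r)%card & regular_off (A `|` ~` B0) x]].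

Definition reduced_divisor (S : set B) : B -> int := fun b => (b \in S)%:Z.

Definition linear_system (D : B -> int) : set K :=
  [set h | h != 0 /\ forall b, (0 <= val b h + (D b)%:E)%E].

Definition class_mod_constants x : set K :=
  [set ff_const a * x | a in [set a : C R | a != 0]].

End Valuation.

Section Discs.
Context {R : realType} {B : riemannSurface R}.

Definition smooth (u : R -> R) : Prop := forall k t, derivable (derive1n k u) t 1.

(* Regular smooth arc: smooth up to the end points (it extends smoothly past
   them, locally), with nonvanishing velocity. *)
Definition smooth_arc (g : R -> B) (a b : R) : Prop :=
  forall t, a <= t <= b -> forall c, atlas c -> chart_dom c (g t) ->
  exists u v : R -> R, [/\ smooth u, smooth v,
    (derive1 u t != 0) || (derive1 v t != 0) &
    \forall s \near t, a <= s <= b -> c (g s) = (u s +i* v s)%C].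

Definition piecewise_smooth (g : R -> B) (a b : R) : Prop :=
  exists2 s, itv_partition a b s & forall i, (i < size s)%N ->
    smooth_arc g (nth b (a :: s) i) (nth b (a :: s) i.+1).

Definition unit_disc : set (C R) := [set w | `|w| <= 1].

(* A closed disc is an embedded image of the closed unit disc, not necessarily
   a disc in some holomorphic coordinate; by compactness of the unit disc, a
   continuous injection is an embedding. *)
Definition closed_disc (p : B) (D : set B) : Prop :=
  exists phi : C R -> B,
    [/\ {within unit_disc, continuous phi}, set_inj unit_disc phi,
        phi 0 = p, phi @` unit_disc = D &
        piecewise_smooth (fun t => phi (cos t +i* sin t)%C) 0 (2 * pi)].

Definition disjoint_discs (S : set B) (U : set B) : Prop :=
  exists D : B -> set B, [/\ forall s, S s -> closed_disc s (D s),
    trivIset S D & U = \bigcup_(s in S) D s].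

End Discs.

(* Main.v *)
Require Import Defs.
Set Warnings "-notation-overridden,-ambiguous-paths,-notation-incompatible-prefix".
From mathcomp Require Import all_boot all_order all_algebra.
From mathcomp Require Import all_classical all_reals all_analysis.
From mathcomp Require Import complex.
From mathcomp Require Import zify ring lra.

(** Already [bounded_units S B0 eps] is finite modulo constants. Its members are
    holomorphic on the open set [B0] and bounded there by [1/eps], so by Cauchy's
    estimate they are equicontinuous on compact subsets of [B0]. Choose
    neighbourhoods [N s] of the discs of [U] whose boundaries lie in [B0]; then
    finitely many classes of members suffice so that [f = x1 / x2] is close to 1
    on all these boundaries whenever [x1] and [x2] are in the same class. As [s]
    is the only possible zero or pole of [f] in [N s], the maximum principle for
    [f - 1] or [1 / f - 1] shows that [f] has neither, so [f] is holomorphic on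
    the compact surface [B], hence constant.

    Cauchy's estimate is obtained without integrals: trapezoidal sums over
    dyadic subdivisions are exactly additive and exact on affine functions, which
    is all that Goursat's bisection argument needs. *)

Set Implicit Arguments.
Unset Strict Implicit.
Unset Printing Implicit Defensive.
Import Order.TTheory GRing.Theory Num.Theory numFieldNormedType.Exports.
Local Open Scope classical_set_scope.
Local Open Scope ring_scope.

(** * The modulus and complex derivatives *)

Section Modulus.
Context {R : realType}.
Implicit Types (z w a b d : C R).

(** Cauchy's estimate is the source of all later complex analysis. Applied to a function it gives
    Lipschitz bounds with uniform constants; applied to difference quotients it gives a second
    derivative, so that [(h w - h a) / (w - a)] extends holomorphically over [a] and zeros can be
    divided out; applied to powers of a function it gives the maximum modulus principle, which is
    usually read off a mean value integral. That a unit has a finite order at each point comes from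
    its inverse: the local numerators of [x] and [x^-1] multiply to a power of the coordinate, so
    only finitely many zeros can be divided out. What shapes the last part is that a unit is not
    controlled inside the discs of [U], where it may have a zero or a pole of any order at the
    centre. Estimates are available on [B0] only, and they reach the centre of a disc through the
    maximum principle, applied to [f] or to its inverse according to the sign of the order. *)

Definition modc z : R := Normc.normc z.
Definition rc (x : R) : C R := (x%:C)%C.
Definition im1 : C R := 'i%C.

(** The norm on [C R] takes its values in [C R] itself, which is only partially ordered; passing to
    the real number [modc z] puts all estimates in an ordered field, where [lra] and [nra] apply. *)
Lemma modcE z : `|z| = rc (modc z). Proof. by case: z. Qed.

Lemma rcD : {morph rc : x y / x + y}. Proof. exact: rmorphD. Qed.
Lemma rcB : {morph rc : x y / x - y}. Proof. exact: rmorphB. Qed.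
Lemma rcM : {morph rc : x y / x * y}. Proof. exact: rmorphM. Qed.
Lemma rc1 : rc 1 = 1. Proof. by []. Qed.
Lemma rc0 : rc 0 = 0. Proof. by []. Qed.
Lemma rcV x : rc x^-1 = (rc x)^-1. Proof. exact: fmorphV. Qed.
Lemma rc_le x y : (rc x <= rc y) = (x <= y). Proof. exact: lecR. Qed.
Lemma rc_lt x y : (rc x < rc y) = (x < y). Proof. exact: ltcR. Qed.

Lemma im1_sqr : im1 * im1 = -1.
Proof. by rewrite -expr2; exact: sqr_i. Qed.

Lemma modcM z w : modc (z * w) = modc z * modc w. Proof. exact: Normc.normcM. Qed.
Lemma modcD z w : modc (z + w) <= modc z + modc w. Proof. exact: le_normcD. Qed.
Lemma modcN z : modc (- z) = modc z. Proof. exact: normcN. Qed.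
Lemma modcB z w : modc (z - w) <= modc z + modc w.
Proof. by rewrite -(modcN w); exact: modcD. Qed.
Lemma modc_distC z w : modc (z - w) = modc (w - z).
Proof. by rewrite -modcN opprB. Qed.
Lemma modc_tri z w a : modc (z - a) <= modc (z - w) + modc (w - a).
Proof. by apply: le_trans (modcD _ _); rewrite addrA subrK. Qed.
Lemma modc_ge0 z : 0 <= modc z. Proof. by case: z => x y; exact: sqrtr_ge0. Qed.
Lemma modc0 : modc 0 = 0. Proof. exact: Normc.normc0. Qed.
Lemma modc1 : modc 1 = 1. Proof. exact: Normc.normc1. Qed.
Lemma modcV z : modc z^-1 = (modc z)^-1. Proof. exact: Normc.normcV. Qed.
Lemma modcX z n : modc (z ^+ n) = modc z ^+ n.
Proof. by elim: n => [|n IH]; rewrite ?expr0 ?modc1// !exprS modcM IH. Qed.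
Lemma modc_eq0 z : (modc z == 0) = (z == 0).
Proof.
apply/eqP/eqP => [|->]; last exact: modc0.
exact: Normc.eq0_normc.
Qed.
Lemma modc_gt0 z : (0 < modc z) = (z != 0).
Proof. by rewrite lt_def modc_ge0 andbT modc_eq0. Qed.
Lemma modc_rc x : modc (rc x) = `|x|.
Proof. by rewrite /modc /rc /= expr0n /= addr0 sqrtr_sqr. Qed.
Lemma modc_im1 : modc im1 = 1.
Proof. by rewrite /modc /= expr0n expr1n add0r sqrtr1. Qed.
Lemma modc_nat n : modc n%:R = n%:R.
Proof.
have -> : n%:R = rc n%:R :> C R by rewrite /rc rmorph_nat.
by rewrite modc_rc ger0_norm.
Qed.

Lemma Re_le_modc z : `|complex.Re z| <= modc z.
Proof.
case: z => x y; rewrite /modc /= -sqrtr_sqr ler_sqrt ?addr_ge0 ?sqr_ge0//.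
by rewrite lerDl sqr_ge0.
Qed.
Lemma Im_le_modc z : `|complex.Im z| <= modc z.
Proof.
case: z => x y; rewrite /modc /= -sqrtr_sqr ler_sqrt ?addr_ge0 ?sqr_ge0//.
by rewrite lerDr sqr_ge0.
Qed.
Lemma modc_le_ReIm z : modc z <= `|complex.Re z| + `|complex.Im z|.
Proof.
have -> : z = rc (complex.Re z) + im1 * rc (complex.Im z) by exact: complexE.
apply: le_trans (modcD _ _) _; rewrite modcM modc_im1 mul1r !modc_rc.
by rewrite -complexE.
Qed.

Lemma cReD z w : complex.Re (z + w : C R) = complex.Re z + complex.Re w.
Proof. by case: z; case: w. Qed.
Lemma cImD z w : complex.Im (z + w : C R) = complex.Im z + complex.Im w.
Proof. by case: z; case: w. Qed.
Lemma cReN z : complex.Re (- z : C R) = - complex.Re z. Proof. by case: z. Qed.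
Lemma cImN z : complex.Im (- z : C R) = - complex.Im z. Proof. by case: z. Qed.
Lemma cReM z w : complex.Re (z * w : C R) =
  complex.Re z * complex.Re w - complex.Im z * complex.Im w.
Proof. by case: z; case: w. Qed.
Lemma cImM z w : complex.Im (z * w : C R) =
  complex.Re z * complex.Im w + complex.Im z * complex.Re w.
Proof. by case: z => a b; case: w. Qed.

Lemma nbhs_modc a (P : set (C R)) :
  nbhs a P <-> exists2 e, 0 < e & forall w, modc (w - a) < e -> P w.
Proof.
split=> [/nbhs_ballP[e /= e0 eP]|[e e0 eP]].
- have e0' : 0 < complex.Re e /\ complex.Im e = 0.
    by case: e e0 {eP} => x y; rewrite ltcE /= => /andP[/eqP ? ?].
  exists (complex.Re e) => [|w wa]; first by case: e0'.
  apply: eP; rewrite /ball /= modcE.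
  have -> : e = rc (complex.Re e) by case: e e0' {wa e0} => x y /= [_ ->].
  by rewrite rc_lt modc_distC.
- apply/nbhs_ballP; exists (rc e) => [/=|w]; first by rewrite -rc0 rc_lt.
  by rewrite /ball /= modcE rc_lt modc_distC; exact: eP.
Qed.

Lemma dnbhs_modc a (P : set (C R)) : a^' P <->
  exists2 e, 0 < e & forall w, w != a -> modc (w - a) < e -> P w.
Proof.
rewrite /dnbhs /within /= -[X in X <-> _]/(nbhs a _) nbhs_modc.
by split=> -[e e0 eP]; exists e => // w; move: (eP w); tauto.
Qed.

(** A first-order expansion rather than a limit of quotients: this is the form that bisection and
    the mean value inequality consume, and nothing has to be divided by [w - a]. *)
Definition cderiv (h : C R -> C R) a d := forall e, 0 < e ->
  exists2 r, 0 < r & forall w, modc (w - a) < r ->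
    modc (h w - h a - d * (w - a)) <= e * modc (w - a).

Lemma cvg_cderiv (h : C R -> C R) a d :
  (t^-1 *: ((h \o shift a) (t *: 1) - h a) @[t --> 0^'] --> d) <-> cderiv h a d.
Proof.
split=> [hd|hd].
- move=> e e0.
  move/cvgr_dist_le : hd => /(_ (rc e)); rewrite -rc0 rc_lt => /(_ e0).
  move=> /dnbhs_modc[r r0 rP]; exists r => // w wr.
  have [->|wa] := eqVneq w a; first by rewrite !subrr mulr0 subr0 modc0 mulr0.
  have wa0 : w - a != 0 by rewrite subr_eq0.
  have := rP (w - a); rewrite subr0 => /(_ wa0 wr) H.
  move: (H); rewrite /= /shift /= scaler1 subrK modcE rc_le => {}H.
  rewrite modc_distC in H.
  have -> : h w - h a - d * (w - a) =
      (w - a) * ((w - a)^-1 * (h w - h a) - d).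
    by field.
  by rewrite modcM mulrC ler_wpM2r ?modc_ge0.
- apply/cvgrPdist_le => e e0.
  have [x x0 ->] : exists2 x, 0 < x & e = rc x.
    case: e e0 => x y; rewrite ltcE /= => /andP[/eqP -> x0].
    by exists x.
  have [r r0 rP] := hd x x0.
  apply/dnbhs_modc; exists r => // t t0; rewrite subr0 => tr.
  have := rP (t + a); rewrite addrK => /(_ tr) H.
  rewrite /= /shift /= scaler1 modcE rc_le.
  have -> : d - t^-1 *: ((h (t + a) - h a) : (C R)^o) =
    - (t^-1 * (h (t + a) - h a - d * t)).
    by rewrite /GRing.scale /=; field.
  by rewrite modcN modcM modcV mulrC ler_pdivrMr ?modc_gt0// .
Qed.

Lemma cderivP (h : C R -> C R) a d : cderiv h a d <-> is_derive a 1 h d.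
Proof.
rewrite -cvg_cderiv; split=> [hd|[/[dup] dh /cvgP + <-]]; last by [].
split; first by apply/cvg_ex; exists d.
by apply: cvg_lim => //; exact: norm_hausdorff.
Qed.

Lemma derivable_cderiv (h : C R -> C R) a :
  derivable h a 1 <-> exists d, cderiv h a d.
Proof.
split=> [/cvg_ex[d /cvg_cderiv hd]|[d /cvg_cderiv hd]]; first by exists d.
by apply/cvg_ex; exists d.
Qed.

End Modulus.

(** * Trapezoidal sums and Goursat's theorem *)

Section Trapezoid.
Context {R : realType}.
Implicit Types (z w a b c d : C R) (f g h : C R -> C R) (P : set (C R)).

Definition mid a b : C R := (a + b) / 2.

Lemma modc_mid a b p : modc (mid a b - p) <= (modc (a - p) + modc (b - p)) / 2.
Proof.
have -> : mid a b - p = ((a - p) + (b - p)) / 2 by rewrite /mid; field.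
by rewrite modcM modcV modc_nat ler_pM2r ?invr_gt0// modcD.
Qed.

Lemma modc_midl a b : modc (mid a b - a) = modc (b - a) / 2.
Proof.
have -> : mid a b - a = (b - a) / 2 by rewrite /mid; field.
by rewrite modcM modcV modc_nat.
Qed.

Lemma modc_midr a b : modc (b - mid a b) = modc (b - a) / 2.
Proof.
have -> : b - mid a b = (b - a) / 2 by rewrite /mid; field.
by rewrite modcM modcV modc_nat.
Qed.

(** What repeated bisection of segments and triangles uses of convexity. *)
Definition mconv P := forall a b, P a -> P b -> P (mid a b).

Lemma mconv_ball p r : mconv [set w | modc (w - p) <= r].
Proof.
move=> a b /= ap bp; apply: le_trans (modc_mid a b p) _.
by rewrite ler_pdivrMr// mulr_natr mulr2n lerD.
Qed.

Lemma closed_ball_modc p r : closed [set w : C R | modc (w - p) <= r].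
Proof.
rewrite -[X in closed X]setCK; apply: open_closedC; rewrite openE => w /= /negP.
rewrite -ltNge => rw; apply/nbhs_modc; exists (modc (w - p) - r).
  by rewrite subr_gt0.
move=> v vw /=; apply/negP; rewrite -ltNge.
have := modc_tri w v p; rewrite (modc_distC w v); lra.
Qed.

Lemma compact_ball_modc p r : compact [set w : C R | modc (w - p) <= r].
Proof.
pose F (xy : R * R) : C R := p + rc xy.1 + im1 * rc xy.2.
have cF : continuous F.
  move=> [x y] A /nbhs_modc[e e0 eA].
  apply/nbhs_ballP; exists (e / 2) => /=; first by rewrite divr_gt0.
  move=> [x' y'] [/= xx yy]; apply: eA; rewrite /F /=.
  have -> : p + rc x' + im1 * rc y' - (p + rc x + im1 * rc y) =
    rc (x' - x) + im1 * rc (y' - y) by rewrite !rcB; ring.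
  apply: le_lt_trans (modcD _ _) _; rewrite modcM modc_im1 mul1r !modc_rc.
  move: xx yy; rewrite /ball /= => xx yy.
  by rewrite [ltRHS](splitr e) ltrD// distrC.
have cK : compact (F @` (`[- r, r] `*` `[- r, r])).
  apply: continuous_compact; first by apply: continuous_subspaceT.
  by apply: compact_setX; exact: segment_compact.
apply: subclosed_compact cK _; first exact: closed_ball_modc.
move=> w /= wr; exists (complex.Re (w - p), complex.Im (w - p)) => /=.
  split; rewrite /= in_itv /= -ler_norml.
    exact: le_trans (Re_le_modc _) wr.
  exact: le_trans (Im_le_modc _) wr.
by rewrite /F /= -addrA -complexE addrC subrK.
Qed.

(** The trapezoidal rule for the integral of [f] along the segment from [a] to [b], cut into [2 ^ n]
    equal pieces; the recursion makes additivity at the midpoint hold by definition. *)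
Fixpoint trap n f a b : C R :=
  if n is m.+1 then trap m f a (mid a b) + trap m f (mid a b) b
  else (f a + f b) / 2 * (b - a).

Lemma mid_sym a b : mid a b = mid b a. Proof. by rewrite /mid addrC. Qed.

Lemma trap_sym n f a b : trap n f b a = - trap n f a b.
Proof.
elim: n a b => [|n IH] a b /=; first by ring.
by rewrite (mid_sym b a) (IH _ b) (IH a) opprD addrC.
Qed.

Lemma trapD n f g a b :
  trap n (fun w => f w + g w) a b = trap n f a b + trap n g a b.
Proof. by elim: n a b => [|n IH] a b /=; rewrite ?IH; ring. Qed.

Lemma trapZ n k f a b : trap n (fun w => k * f w) a b = k * trap n f a b.
Proof. by elim: n a b => [|n IH] a b /=; rewrite ?IH; ring. Qed.

Lemma trap_ext n P f g a b : mconv P -> P a -> P b ->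
  (forall w, P w -> f w = g w) -> trap n f a b = trap n g a b.
Proof.
move=> cP + + fg; elim: n a b => [|n IH] a b Pa Pb /=; first by rewrite !fg.
by rewrite !IH//; exact: cP.
Qed.

(** The right-hand side is the increment of the primitive [al * w + be * w ^+ 2 / 2], so it cancels
    around a triangle, at every level [n]. *)
Lemma trap_affine n al be a b :
  trap n (fun w => al + be * w) a b =
  al * (b - a) + be * (b ^+ 2 - a ^+ 2) / 2.
Proof. by elim: n a b => [|n IH] a b /=; rewrite ?IH /mid; field. Qed.

Lemma trap_comp n f p k a b :
  trap n f (p + k * a) (p + k * b) = k * trap n (fun w => f (p + k * w)) a b.
Proof.
elim: n a b => [|n IH] a b /=; first by field.
have -> : mid (p + k * a) (p + k * b) = p + k * mid a b by rewrite /mid; field.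
by rewrite !IH mulrDr.
Qed.

Lemma trap_bound n P f a b M : mconv P -> P a -> P b ->
  (forall w, P w -> modc (f w) <= M) -> modc (trap n f a b) <= M * modc (b - a).
Proof.
move=> cP + + fM; elim: n a b => [|n IH] a b Pa Pb /=.
  rewrite modcM ler_wpM2r ?modc_ge0// modcM modcV modc_nat.
  rewrite ler_pdivrMr// mulr_natr mulr2n; apply: le_trans (modcD _ _) _.
  by rewrite lerD// fM.
apply: le_trans (modcD _ _) _.
have H1 := IH _ _ Pa (cP _ _ Pa Pb); have H2 := IH _ _ (cP _ _ Pa Pb) Pb.
move: H1 H2; rewrite modc_midl modc_midr; lra.
Qed.

Definition tri n f a b c := trap n f a b + trap n f b c + trap n f c a.

(** Each inner edge is traversed twice, in opposite directions, and each outer edge is cut at its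
    midpoint, which lowers the level by one. *)
Lemma tri_split n f a b c : tri n.+1 f a b c =
  tri n f a (mid a b) (mid c a) + tri n f (mid a b) b (mid b c) +
  tri n f (mid c a) (mid b c) c + tri n f (mid a b) (mid b c) (mid c a).
Proof.
rewrite /tri /= (trap_sym n f (mid c a) (mid a b)).
rewrite (trap_sym n f (mid b c) (mid c a)) (trap_sym n f (mid a b) (mid b c)).
ring.
Qed.

Lemma tri_bound n P f a b c M D : mconv P -> P a -> P b -> P c -> 0 <= M ->
  modc (b - a) <= D -> modc (c - b) <= D -> modc (a - c) <= D ->
  (forall w, P w -> modc (f w) <= M) -> modc (tri n f a b c) <= 3 * (M * D).
Proof.
move=> cP Pa Pb Pc M0 ab bc ca fM.
have H x y : P x -> P y -> modc (y - x) <= D -> modc (trap n f x y) <= M * D.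
  move=> Px Py xy; apply: le_trans (trap_bound n cP Px Py fM) _.
  by rewrite ler_wpM2l.
apply: le_trans (modcD _ _) _; have := modcD (trap n f a b) (trap n f b c).
have := H _ _ Pa Pb ab; have := H _ _ Pb Pc bc; have := H _ _ Pc Pa ca; lra.
Qed.

End Trapezoid.

(** * Goursat's theorem by bisection *)

Section Goursat.
Context {R : realType}.
Implicit Types (z w a b c d : C R) (f g h : C R -> C R) (P : set (C R)).

Variables (Om : set (C R)) (f : C R -> C R).
Hypothesis cOm : compact Om.
Hypothesis mOm : mconv Om.
Hypothesis df : forall w, Om w -> exists d, cderiv f w d.

(** Sums around a triangle vanish only in the limit of fine subdivisions, so bisection follows
    triangles whose sums exceed [eta] at arbitrarily high levels. *)
Let bad (eta : R) a b c :=
  forall n0, exists2 n, (n0 <= n)%N & eta < modc (tri n f a b c).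

(** Eventual bounds by [eta / 4] on the four pieces would add up, one level higher, to an eventual
    bound by [eta]. *)
Let bad_split eta a b c : bad eta a b c ->
  [\/ bad (eta / 4) a (mid a b) (mid c a), bad (eta / 4) (mid a b) b (mid b c),
      bad (eta / 4) (mid c a) (mid b c) c |
      bad (eta / 4) (mid a b) (mid b c) (mid c a)].
Proof.
move=> B; apply: contrapT => H.
have nb x y z : ~ bad (eta / 4) x y z ->
    exists n0, forall n, (n0 <= n)%N -> modc (tri n f x y z) <= eta / 4.
  move=> /existsNP[n0 Hn0]; exists n0 => n n0n; rewrite leNgt; apply/negP => ?.
  by apply: Hn0; exists n.
have [n1 H1] : exists n0, forall n, (n0 <= n)%N ->
  modc (tri n f a (mid a b) (mid c a)) <= eta / 4.
  by apply: nb => ?; apply: H; exact: Or41.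
have [n2 H2] : exists n0, forall n, (n0 <= n)%N ->
  modc (tri n f (mid a b) b (mid b c)) <= eta / 4.
  by apply: nb => ?; apply: H; exact: Or42.
have [n3 H3] : exists n0, forall n, (n0 <= n)%N ->
  modc (tri n f (mid c a) (mid b c) c) <= eta / 4.
  by apply: nb => ?; apply: H; exact: Or43.
have [n4 H4] : exists n0, forall n, (n0 <= n)%N ->
  modc (tri n f (mid a b) (mid b c) (mid c a)) <= eta / 4.
  by apply: nb => ?; apply: H; exact: Or44.
(* The extra successor rules out level 0, at which [tri_split] does not apply. *)
have [[|n] nN] := B (n1 + n2 + n3 + n4).+1 => //.
rewrite tri_split; apply/negP; rewrite -leNgt.
move: nN; rewrite ltnS => nN.
have {}H1 := H1 n ltac:(lia).
have {}H2 := H2 n ltac:(lia).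
have {}H3 := H3 n ltac:(lia).
have {}H4 := H4 n ltac:(lia).
apply: le_trans (modcD _ _) _; apply: le_trans (lerD (modcD _ _) (lexx _)) _.
apply: le_trans (lerD (lerD (modcD _ _) (lexx _)) (lexx _)) _.
lra.
Qed.

(** With each bisection the threshold is divided by 4 and the bound on the sides by 2, so the ratio
    of the threshold to the square of that bound stays constant. *)
Let st (eta D : R) (k : nat) (T : C R * C R * C R) :=
  let: (a, b, c) := T in
  [/\ Om a, Om b, Om c & bad (eta * (2^-1 ^+ k) ^+ 2) a b c] /\
  [/\ modc (b - a) <= D * 2^-1 ^+ k, modc (c - b) <= D * 2^-1 ^+ k &
      modc (a - c) <= D * 2^-1 ^+ k].

Let st_next eta D k T : 0 <= D -> st eta D k T ->
  exists2 T', st eta D k.+1 T' & modc (T'.1.1 - T.1.1) <= D * 2^-1 ^+ k.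
Proof.
move: T => [[a b] c] D0 [[Oa Ob Oc B] [ab bc ca]].
have e4 : eta * (2^-1 ^+ k) ^+ 2 / 4 = eta * (2^-1 ^+ k.+1) ^+ 2 :> R.
  by rewrite (exprS _ k); field.
have eD : D * 2^-1 ^+ k.+1 = D * 2^-1 ^+ k / 2 :> R by rewrite (exprS _ k); field.
have x0 : 0 <= D * 2^-1 ^+ k.
  by rewrite mulr_ge0// exprn_ge0// invr_ge0.
have Oab := mOm Oa Ob; have Obc := mOm Ob Oc; have Oca := mOm Oc Oa.
move: ab bc ca x0; set x := D * _ => ab bc ca x0.
have m1 : modc (mid a b - a) = modc (b - a) / 2 by exact: modc_midl.
have m2 : modc (mid c a - c) = modc (a - c) / 2 by exact: modc_midl.
have mm (u v w : C R) : modc (mid u v - mid w u) = modc (v - w) / 2.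
  have -> : mid u v - mid w u = (v - w) / 2 by rewrite /mid; field.
  by rewrite modcM modcV modc_nat.
have mm' (u v w : C R) : modc (mid u v - mid w u) = modc (w - v) / 2.
  by rewrite mm modc_distC.
have half (y : R) : y <= x -> y / 2 <= x / 2 by move=> ?; rewrite ler_pM2r// invr_gt0.
have half' (y : R) : y <= x -> y / 2 <= x by move=> ?; lra.
case: (bad_split B); rewrite e4 => B'.
- exists (a, mid a b, mid c a) => /=; last by rewrite subrr modc0.
  split => //; rewrite eD; split; first by rewrite modc_midl half.
    by rewrite modc_distC mm half// modc_distC.
  by rewrite modc_midr half.
- exists (mid a b, b, mid b c) => /=; last by rewrite modc_midl half'.
  split => //; rewrite eD; split; first by rewrite modc_midr half.
    by rewrite modc_midl half.
  by rewrite modc_distC mm half// modc_distC.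
- exists (mid c a, mid b c, c) => /=; last first.
    by rewrite modc_distC modc_midr half'.
  split => //; rewrite eD; split.
  + by rewrite modc_distC mm half// modc_distC.
  + by rewrite modc_midr half.
  + by rewrite modc_midl half.
- exists (mid a b, mid b c, mid c a) => /=; last by rewrite modc_midl half'.
  split => //; rewrite eD; split.
  + by rewrite mm half// modc_distC.
  + by rewrite mm half// modc_distC.
  + by rewrite mm half// modc_distC.
Qed.

(** Bad triangles shrink to a point [p] at which [f] is affine up to a small multiple of the
    distance. The affine part has sum zero, and the rest is bounded by a small multiple of the
    squared size, below the threshold. *)
Theorem goursat a b c : Om a -> Om b -> Om c -> forall eta, 0 < eta ->
  exists n0, forall n, (n0 <= n)%N -> modc (tri n f a b c) <= eta.
Proof.
move=> Oa Ob Oc eta eta0; apply: contrapT => nB.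
have B : bad eta a b c.
  move=> n0; apply: contrapT => H; apply: nB; exists n0 => n n0n.
  by rewrite leNgt; apply/negP => ?; apply: H; exists n.
pose D := modc (b - a) + modc (c - b) + modc (a - c).
have D0 : 0 <= D by rewrite !addr_ge0// modc_ge0.
have st0 : st eta D 0 (a, b, c).
  split; rewrite expr0 ?expr1n mulr1; split => //; rewrite /D.
  - by rewrite -addrA lerDl addr_ge0 ?modc_ge0.
  - by rewrite addrAC lerDr addr_ge0 ?modc_ge0.
  - by rewrite lerDr addr_ge0 ?modc_ge0.
have [nx nxP] : {nx & forall kT : nat * (C R * C R * C R), st eta D kT.1 kT.2 ->
    st eta D kT.1.+1 (nx kT) /\
    modc ((nx kT).1.1 - kT.2.1.1) <= D * 2^-1 ^+ kT.1}.
  apply: (@choice _ _ (fun kT T' => st eta D kT.1 kT.2 ->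
    st eta D kT.1.+1 T' /\ modc (T'.1.1 - kT.2.1.1) <= D * 2^-1 ^+ kT.1)).
  move=> [k T] /=; have [/(st_next D0)[T' ? ?]|H] := pselect (st eta D k T).
    by exists T'.
  by exists T.
pose T := fix T k := if k is k'.+1 then nx (k', T k') else (a, b, c).
have stT k : st eta D k (T k).
  by elim: k => [//|k IH]; exact: (nxP (k, T k) IH).1.
have stepT k : modc ((T k.+1).1.1 - (T k).1.1) <= D * 2^-1 ^+ k.
  exact: (nxP (k, T k) (stT k)).2.
have distT j k : modc ((T (j + k)%N).1.1 - (T k).1.1) <=
    2 * D * (2^-1 ^+ k - 2^-1 ^+ (j + k)).
  elim: j => [|j IH]; first by rewrite !add0n !subrr modc0 mulr0.
  apply: le_trans (modc_tri _ (T (j + k)%N).1.1 _) _.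
  apply: le_trans (lerD (stepT (j + k)%N) IH) _.
  rewrite addSn [2^-1 ^+ (j + k).+1]exprS; lra.
have OT k : Om (T k).1.1 by have := stT k; case: (T k) => [[? ?] ?] [[]].
have FO : ((fun k => (T k).1.1) @ \oo) Om by exists 0%N => // k _; exact: OT.
(* By [distT] the first vertices form a Cauchy sequence, so a cluster point in [Om] is its limit,
   with the explicit rate [pk]. *)
have [p [Op clp]] := @cOm _ _ FO.
have pk k : modc ((T k).1.1 - p) <= 2 * (D * 2^-1 ^+ k).
  apply/ler_addgt0Pr => e e0.
  have [||w [[j /= kj <-] wp]] := clp [set (T j).1.1 | j in [set j | (k <= j)%N]]
      [set w | modc (w - p) < e].
  - by exists k => // j /= kj; exists j.
  - by apply/nbhs_modc; exists e.
  apply: le_trans (modc_tri _ (T j).1.1 _) _.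
  apply: lerD; last exact: ltW.
  rewrite modc_distC; have := distT (j - k)%N k; rewrite subnK// => H.
  apply: le_trans H _; rewrite mulrA ler_wpM2l ?mulr_ge0//.
  by rewrite gerBl exprn_ge0// invr_ge0.
have [d hd] := df Op.
(* The final bound at scale [x] is [9 * kap * D ^+ 2 * x ^+ 2], and this choice keeps it at most
   [eta * x ^+ 2]; the [+ 1] covers [D = 0]. *)
pose kap := eta / (9 * D ^+ 2 + 1).
have den0 : 0 < 9 * D ^+ 2 + 1 by rewrite ltr_wpDl// mulr_ge0// sqr_ge0.
have kap0 : 0 < kap by rewrite divr_gt0.
have [r r0 rP] := hd kap kap0.
have [k kr] : exists k, 3 * (D * 2^-1 ^+ k) < r.
  have : (fun k => 3 * (D * 2^-1 ^+ k)) @ \oo --> (3 * (D * 0) : R).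
    apply: cvgMl_tmp; apply: cvgMl_tmp; apply: cvg_expr.
    by rewrite ger0_norm ?invr_ge0// invf_lt1// ltr1n.
  rewrite !mulr0 => /cvgr_lt /(_ _ r0)[k _ kP].
  by exists k; exact: kP (leqnn k).
have := stT k; have := pk k; case: (T k) => [[a' b'] c'] /=.
set x : R := 2^-1 ^+ k in kr *.
move=> ap [[Oa' Ob' Oc' B'] [ab bc ca]].
have [n _] := B' 0%N; apply/negP; rewrite -leNgt.
(* At most [2 * (D * x)] from [p] to the first vertex, and one side of length at most [D * x] to
   each other vertex. *)
pose P := [set w | modc (w - p) <= 3 * (D * x)].
have x0 : 0 < x by rewrite exprn_gt0// invr_gt0.
have Dx0 : 0 <= D * x by rewrite mulr_ge0// ltW.
have Pa : P a' by rewrite /P /=; lra.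
have Pb : P b' by have := modc_tri b' a' p; rewrite /P /=; lra.
have Pc : P c' by have := modc_tri c' a' p; rewrite (modc_distC c' a') /P /=; lra.
have mP : mconv P by exact: mconv_ball.
pose rest w := f w - (f p - d * p + d * w).
have trE u v : P u -> P v -> trap n f u v =
    trap n rest u v + ((f p - d * p) * (v - u) + d * (v ^+ 2 - u ^+ 2) / 2).
  move=> Pu Pv; rewrite -(trap_affine n) -trapD; apply: trap_ext mP Pu Pv _.
  by move=> w _; rewrite /rest; ring.
have -> : tri n f a' b' c' = tri n rest a' b' c'.
  by rewrite /tri !trE//; field.
have restP w : P w -> modc (rest w) <= kap * (3 * (D * x)).
  move=> Pw; have wr : modc (w - p) < r by exact: le_lt_trans Pw kr.
  have -> : rest w = f w - f p - d * (w - p) by rewrite /rest; ring.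
  by apply: le_trans (rP w wr) _; rewrite ler_wpM2l// ltW.
have K0 : 0 <= kap * (3 * (D * x)) by apply: mulr_ge0 (ltW kap0) _; exact: mulr_ge0.
apply: le_trans (tri_bound n mP Pa Pb Pc K0 ab bc ca restP) _.
have -> : 3 * (kap * (3 * (D * x)) * (D * x)) =
   (eta * x ^+ 2) * (9 * D ^+ 2 / (9 * D ^+ 2 + 1)).
  by rewrite /kap; field; rewrite gt_eqF.
apply: ler_piMr; first exact: mulr_ge0 (ltW eta0) (sqr_ge0 x).
by rewrite ler_pdivrMr// mul1r lerDl.
Qed.

End Goursat.

(** * Cauchy's estimate *)

Section Diamond.
Context {R : realType}.
Implicit Types (z w a b c d e : C R) (f g h : C R -> C R) (P : set (C R)).

Definition edge n f a e := trap n f (a + e) (a + im1 * e).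

(** The contour that replaces the circle: the square with corners at [e], [im1 * e], [- e] and
    [- (im1 * e)] from the centre [a], invariant under rotation by [im1]. *)
Definition diamond n f a e :=
  edge n f a e + edge n f a (im1 * e) + edge n f a (- e) +
  edge n f a (- (im1 * e)).

(** The real linear form that equals 1 on the edge from [1] to [im1]. A positive lower bound on it
    cuts out a region that is closed under midpoints and stays away from the centre of the
    diamond. *)
Definition resum z : R := complex.Re z + complex.Im z.

Lemma resum_le z : `|resum z| <= 2 * modc z.
Proof.
apply: le_trans (ler_normD _ _) _; rewrite mulr_natl mulr2n.
by rewrite lerD ?Re_le_modc ?Im_le_modc.
Qed.

Lemma resumD z w : resum (z + w) = resum z + resum w.
Proof. by rewrite /resum cReD cImD; lra. Qed.

Lemma resum_half z : resum (z / 2) = resum z / 2.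
Proof.
have {2}-> : z = z / 2 + z / 2 by field.
by rewrite resumD; field.
Qed.

Lemma resum_im1 : resum im1 = 1. Proof. by rewrite /resum /= add0r. Qed.
Lemma resum_1 : resum 1 = 1. Proof. by rewrite /resum /= addr0. Qed.

Definition halfplane a e (t : R) := [set w | t <= resum ((w - a) / e)].

Lemma mconv_halfplane a e t : mconv (halfplane a e t).
Proof.
move=> u v; rewrite /halfplane /= => tu tv.
have -> : (mid u v - a) / e = ((u - a) / e + (v - a) / e) / 2.
  by rewrite /mid; move: (e^-1) => k; field.
by rewrite resum_half resumD; lra.
Qed.

Lemma mconvI P Q : mconv P -> mconv Q -> @mconv R (P `&` Q).
Proof. by move=> cP cQ a b [? ?] [? ?]; split; [exact: cP|exact: cQ]. Qed.

Lemma closed_halfplane a e t : e != 0 -> closed (halfplane a e t).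
Proof.
move=> e0.
rewrite -[X in closed X]setCK; apply: open_closedC; rewrite openE => w /= /negP.
rewrite -ltNge => wt; apply/nbhs_modc.
exists ((t - resum ((w - a) / e)) / 2 * modc e).
  by rewrite mulr_gt0 ?modc_gt0// divr_gt0// subr_gt0.
move=> v vw /=; apply/negP; rewrite -ltNge.
have -> : (v - a) / e = (v - w) / e + (w - a) / e by field.
rewrite resumD -ltrBrDr; apply: le_lt_trans (ler_norm _) _.
apply: le_lt_trans (resum_le _) _.
rewrite modcM modcV mulrA ltr_pdivrMr ?modc_gt0//.
by move: vw; set x := modc e; lra.
Qed.

Lemma compact_halfdisc a e t r : e != 0 ->
  compact ([set w | modc (w - a) <= r] `&` halfplane a e t).
Proof.
move=> e0; apply: (subclosed_compact _ (@compact_ball_modc _ a r)); last by move=> w [].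
by apply: closedI; [exact: closed_ball_modc|exact: closed_halfplane].
Qed.

Lemma halfplane_modc a e t w : e != 0 -> halfplane a e t w ->
  t * modc e <= 2 * modc (w - a).
Proof.
move=> e0; rewrite /halfplane /= => tw.
have := le_trans (ler_norm _) (resum_le ((w - a) / e)).
rewrite modcM modcV mulrA => /(le_trans tw).
by rewrite ler_pdivlMr ?modc_gt0.
Qed.

Lemma modc_im1M e : modc (im1 * e) = modc e.
Proof. by rewrite modcM modc_im1 mul1r. Qed.

Lemma im1M e : im1 * (im1 * e) = - e.
Proof. by rewrite mulrA im1_sqr mulN1r. Qed.

Section Shrink.
Variables (f : C R -> C R) (a : C R) (s : R).
Hypothesis df : forall w, w != a -> modc (w - a) <= s -> exists d, cderiv f w d.

(** Of the four pieces of the triangle with a vertex at [a], one is its half-size copy at [a]; the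
    other three avoid [a], so Goursat's theorem makes them negligible. *)
Let corner_tri e : e != 0 -> modc e <= s -> forall eta : R, 0 < eta ->
  exists n0, forall n, (n0 <= n)%N ->
    modc (tri n.+1 f a (a + e) (a + im1 * e) -
          tri n f a (a + e / 2) (a + im1 * (e / 2))) <= eta.
Proof.
move=> e0 es eta eta0.
(* Midpoints of the sides through [a] have [resum] equal to 1/2 in units of [e], so the three pieces
   without the vertex [a] have all their vertices here. *)
pose Om := [set w | modc (w - a) <= s] `&` halfplane a e 2^-1.
have cOm : compact Om by exact: compact_halfdisc.
have mOm : mconv Om.
  by apply: mconvI; [exact: mconv_ball|exact: mconv_halfplane].
have dOm w : Om w -> exists d, cderiv f w d.
  move=> [ws /(halfplane_modc e0) H]; apply: df => //.
  rewrite -subr_eq0 -modc_gt0; have : 0 < modc e by rewrite modc_gt0.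
  lra.
have OmI u : modc u <= 1 -> 2^-1 <= resum u -> Om (a + u * e).
  move=> u1 uu; split => /=; rewrite /halfplane /= addrAC subrr add0r.
    by rewrite modcM; apply: le_trans es; rewrite ler_piMl// modc_ge0.
  by rewrite mulfK.
have h1 : modc (2^-1 : C R) = 2^-1 by rewrite modcV modc_nat.
have O1 : Om (a + e).
  by rewrite -{1}[e]mul1r; apply: OmI; rewrite ?modc1 ?resum_1// invf_le1 ?ler1n.
have O2 : Om (a + im1 * e).
  by apply: OmI; rewrite ?modc_im1 ?resum_im1// invf_le1 ?ler1n.
have O3 : Om (mid a (a + e)).
  have -> : mid a (a + e) = a + 2^-1 * e by rewrite /mid; field.
  apply: OmI; first by rewrite h1 invf_le1 ?ler1n.
  by rewrite (_ : 2^-1 = 1 / 2 :> C R) ?mul1r// -[X in resum X]mul1r resum_half resum_1 mul1r.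
have O4 : Om (mid (a + im1 * e) a).
  have -> : mid (a + im1 * e) a = a + (im1 / 2) * e by rewrite /mid; field.
  apply: OmI; last by rewrite resum_half resum_im1 mul1r.
  by rewrite modcM modc_im1 h1 mul1r invf_le1 ?ler1n.
have O5 : Om (mid (a + e) (a + im1 * e)) by exact: mOm.
have eta3 : 0 < eta / 3 by rewrite divr_gt0.
have [n1 H1] := goursat cOm mOm dOm O3 O1 O5 eta3.
have [n2 H2] := goursat cOm mOm dOm O4 O5 O2 eta3.
have [n3 H3] := goursat cOm mOm dOm O3 O5 O4 eta3.
exists (n1 + n2 + n3)%N => n nn.
have {}H1 := H1 n ltac:(lia); have {}H2 := H2 n ltac:(lia).
have {}H3 := H3 n ltac:(lia).
rewrite tri_split.
have -> : a + e / 2 = mid a (a + e) by rewrite /mid; field.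
have -> : a + im1 * (e / 2) = mid (a + im1 * e) a by rewrite /mid; field.
set x := tri n f a _ _; set y := tri n f _ _ _ in H1 *.
set z := tri n f _ _ _ in H2 *; set t := tri n f _ _ _ in H3 *.
have -> : x + y + z + t - x = y + z + t by ring.
have := modcD (y + z) t; have := modcD y z; lra.
Qed.

(** The segments joining the corners to the centre are traversed once in each direction. The
    singularity of [f] at [a] does no harm: [f a] is some number, and it cancels. *)
Let diamondE n e : diamond n f a e =
  tri n f a (a + e) (a + im1 * e) +
  tri n f a (a + im1 * e) (a + im1 * (im1 * e)) +
  tri n f a (a - e) (a + im1 * (- e)) +
  tri n f a (a + - (im1 * e)) (a + im1 * (- (im1 * e))).
Proof.
rewrite /diamond /edge /tri !mulrN !im1M !opprK.
rewrite (trap_sym n f a (a + im1 * e)) (trap_sym n f a (a - e)).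
rewrite (trap_sym n f a (a - im1 * e)) (trap_sym n f a (a + e)).
ring.
Qed.

Lemma diamond_step e : e != 0 -> modc e <= s -> forall eta : R, 0 < eta ->
  exists n0, forall n, (n0 <= n)%N ->
    modc (diamond n.+1 f a e - diamond n f a (e / 2)) <= eta.
Proof.
move=> e0 es eta eta0; have eta4 : 0 < eta / 4 by rewrite divr_gt0.
have i0 : im1 * e != 0 by rewrite -modc_gt0 modc_im1M modc_gt0.
have [n1 H1] := corner_tri e0 es eta4.
have [n2 H2] := corner_tri i0 (eq_ind_r (fun x => x <= s) es (modc_im1M e)) eta4.
have [n3 H3] : exists n0, forall n, (n0 <= n)%N ->
    modc (tri n.+1 f a (a - e) (a + im1 * - e) -
          tri n f a (a + - e / 2) (a + im1 * (- e / 2))) <= eta / 4.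
  by apply: corner_tri; rewrite ?oppr_eq0 ?modcN.
have [n4 H4] : exists n0, forall n, (n0 <= n)%N ->
    modc (tri n.+1 f a (a - im1 * e) (a + im1 * - (im1 * e)) -
          tri n f a (a + - (im1 * e) / 2) (a + im1 * (- (im1 * e) / 2))) <= eta / 4.
  by apply: corner_tri; rewrite ?oppr_eq0 ?modcN ?modc_im1M.
exists (n1 + n2 + n3 + n4)%N => n nn.
have {}H1 := H1 n ltac:(lia); have {}H2 := H2 n ltac:(lia).
have {}H3 := H3 n ltac:(lia); have {}H4 := H4 n ltac:(lia).
rewrite !diamondE.
move: H1 H2 H3 H4; rewrite !mulNr -!mulrA.
set x := _ - _; set y := _ - _; set z := _ - _; set t := _ - _ => H1 H2 H3 H4.
rewrite [X in modc X](_ : _ = x + y + z + t); last first.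
  by rewrite /x /y /z /t; ring.
have := modcD (x + y + z) t; have := modcD (x + y) z; have := modcD x y; lra.
Qed.

(** Discrete deformation of the contour: the level drops by [k] while the square shrinks by
    [2 ^+ k], so the pieces of both sums have the same length. *)
Lemma diamond_steps k e : e != 0 -> modc e <= s -> forall eta : R, 0 < eta ->
  exists n0, forall n, (n0 <= n)%N ->
    modc (diamond (k + n) f a e - diamond n f a (e / 2 ^+ k)) <= eta.
Proof.
move=> + + eta; elim: k e eta => [|k IH] e eta e0 es eta0.
  by exists 0%N => n _; rewrite add0n expr0 divr1 subrr modc0 ltW.
have eta2 : 0 < eta / 2 by rewrite divr_gt0.
have e20 : e / 2 != 0 by rewrite mulf_neq0// invr_eq0 pnatr_eq0.
have e2s : modc (e / 2) <= s.
  by rewrite modcM modcV modc_nat; have := modc_ge0 e; lra.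
have [n1 H1] := diamond_step e0 es eta2.
have [n2 H2] := IH _ _ e20 e2s eta2.
exists (n1 + n2)%N => n nn.
have {}H1 := H1 (k + n)%N ltac:(lia); have {}H2 := H2 n ltac:(lia).
rewrite addSn exprS invfM mulrA.
apply: le_trans (modc_tri _ (diamond (k + n) f a (e / 2)) _) _; lra.
Qed.

End Shrink.

(** The edge stays at distance between [modc e / 2] and [modc e] from [a], and its length is at most
    [2 * modc e]. *)
Lemma edge_bound n f a e M : e != 0 ->
  (forall w, modc (w - a) <= modc e -> modc e <= 2 * modc (w - a) ->
     modc (f w) <= M) ->
  modc (edge n f a e) <= 2 * (M * modc e).
Proof.
move=> e0 fM.
pose P := [set w | modc (w - a) <= modc e] `&` halfplane a e 1.
have mP : mconv P.
  by apply: mconvI; [exact: mconv_ball|exact: mconv_halfplane].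
have PI u : modc u <= 1 -> 1 <= resum u -> P (a + u * e).
  move=> u1 uu; split => /=; rewrite /halfplane /= addrAC subrr add0r.
    by rewrite modcM; rewrite ler_piMl// modc_ge0.
  by rewrite mulfK.
have P1 : P (a + e).
  by rewrite -{1}[e]mul1r; apply: PI; rewrite ?modc1 ?resum_1.
have P2 : P (a + im1 * e) by apply: PI; rewrite ?modc_im1 ?resum_im1.
have fP w : P w -> modc (f w) <= M.
  by move=> [we /(halfplane_modc e0)]; rewrite mul1r; exact: fM.
have M0 : 0 <= M by exact: le_trans (modc_ge0 _) (fP _ P1).
apply: le_trans (trap_bound n mP P1 P2 fP) _.
have -> : a + im1 * e - (a + e) = (im1 * e) - e by ring.
have := modcB (im1 * e) e; rewrite modc_im1M => H.
apply: le_trans (ler_wpM2l M0 H) _; lra.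
Qed.

Lemma diamond_bound n f a e M : e != 0 ->
  (forall w, modc (w - a) <= modc e -> modc e <= 2 * modc (w - a) ->
     modc (f w) <= M) ->
  modc (diamond n f a e) <= 8 * (M * modc e).
Proof.
move=> e0 fM; rewrite /diamond.
have i0 : im1 * e != 0 by rewrite -modc_gt0 modc_im1M modc_gt0.
have H1 := edge_bound n e0 fM.
have H2 : modc (edge n f a (im1 * e)) <= 2 * (M * modc e).
  by rewrite -(modc_im1M e); apply: edge_bound => // w; rewrite modc_im1M; exact: fM.
have H3 : modc (edge n f a (- e)) <= 2 * (M * modc e).
  by rewrite -(modcN e); apply: edge_bound; rewrite ?oppr_eq0// => w; rewrite modcN; exact: fM.
have H4 : modc (edge n f a (- (im1 * e))) <= 2 * (M * modc e).
  rewrite -(modc_im1M e) -(modcN (_ * _)); apply: edge_bound; rewrite ?oppr_eq0// => w.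
  by rewrite modcN modc_im1M; exact: fM.
apply: le_trans (modcD _ _) _; apply: le_trans (lerD (modcD _ _) (lexx _)) _.
apply: le_trans (lerD (lerD (modcD _ _) (lexx _)) (lexx _)) _.
lra.
Qed.

(** A discrete form of the removable singularity argument: [(w - a) * f w] tends to 0 while the
    length of the contour is proportional to its distance from [a], so shrinking the contour leaves
    nothing. *)
Lemma diamond_cvg0 f a s e : 
  (forall w, w != a -> modc (w - a) <= s -> exists d, cderiv f w d) ->
  (forall eta : R, 0 < eta -> exists2 r : R, 0 < r & forall w, w != a ->
    modc (w - a) < r -> modc (f w) * modc (w - a) <= eta) ->
  e != 0 -> modc e <= s -> forall eta : R, 0 < eta ->
  exists n0, forall n, (n0 <= n)%N -> modc (diamond n f a e) <= eta.
Proof.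
move=> df f0 e0 es eta eta0.
(* A factor 8 is lost in [diamond_bound] and a factor 2 in the distance to [a], which leaves
   [eta / 2]; the other half pays for [diamond_steps]. *)
have eta32 : 0 < eta / 32 by rewrite divr_gt0.
have [r r0 rP] := f0 _ eta32.
have [k kr] : exists k, modc e * 2^-1 ^+ k < r.
  have : (fun k => modc e * 2^-1 ^+ k) @ \oo --> (modc e * 0 : R).
    apply: cvgMl_tmp; apply: cvg_expr.
    by rewrite ger0_norm ?invr_ge0// invf_lt1// ltr1n.
  rewrite mulr0 => /cvgr_lt /(_ _ r0)[k _ kP].
  by exists k; exact: kP (leqnn k).
have eta2 : 0 < eta / 2 by rewrite divr_gt0.
have [n0 n0P] := diamond_steps df k e0 es eta2.
exists (n0 + k)%N => n nn; have {}n0P := n0P (n - k)%N ltac:(lia).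
rewrite subnKC in n0P; last lia.
set e' := e / 2 ^+ k in n0P.
have e'0 : e' != 0 by rewrite mulf_neq0// invr_eq0 expf_neq0// pnatr_eq0.
have me' : modc e' < r by rewrite modcM modcV modcX modc_nat -exprVn.
have B : modc (diamond (n - k) f a e') <= 8 * (eta / 16 / modc e' * modc e').
  apply: diamond_bound => // w wa aw.
  have e'p : 0 < modc e' by rewrite modc_gt0.
  have wa0 : w != a by rewrite -subr_eq0 -modc_gt0; lra.
  have H := rP w wa0 (le_lt_trans wa me').
  by rewrite ler_pdivlMr//; have := ler_wpM2l (modc_ge0 (f w)) aw; lra.
rewrite mulfVK ?gt_eqF ?modc_gt0// in B.
have := modc_tri (diamond n f a e) (diamond (n - k) f a e') 0.
rewrite !subr0; lra.
Qed.

End Diamond.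

(** * Test sums for the Cauchy kernel, and the estimate *)

Section CauchyEstimate.
Context {R : realType}.
Implicit Types (z w a b c d e : C R) (f g h : C R -> C R) (P : set (C R)).

Lemma edgeD n f g a e :
  edge n (fun w => f w + g w) a e = edge n f a e + edge n g a e.
Proof. exact: trapD. Qed.

Lemma edgeZ n k f a e : edge n (fun w => k * f w) a e = k * edge n f a e.
Proof. exact: trapZ. Qed.

Lemma edge_ext n f g a e : e != 0 -> (forall w, w != a -> f w = g w) ->
  edge n f a e = edge n g a e.
Proof.
move=> e0 fg; apply: (@trap_ext _ _ (halfplane a e 1)).
- exact: mconv_halfplane.
- by rewrite /halfplane /= addrAC subrr add0r divff// resum_1.
- by rewrite /halfplane /= addrAC subrr add0r mulfK// resum_im1.
- move=> w /(halfplane_modc e0); rewrite mul1r => H; apply: fg.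
  rewrite -subr_eq0 -modc_gt0; have : 0 < modc e by rewrite modc_gt0.
  lra.
Qed.

Lemma edge_rot n f k a e : (forall w, f (a + im1 * w) = k * f (a + w)) ->
  edge n f a (im1 * e) = im1 * k * edge n f a e.
Proof.
move=> fk; rewrite /edge trap_comp -mulrA; congr (_ * _).
have := trap_comp n f a 1 e (im1 * e).
rewrite !mul1r => ->; rewrite -trapZ; congr trap.
by apply/funext => w; rewrite fk mul1r.
Qed.

Lemma diamond_rot n f k a e : (forall w, f (a + im1 * w) = k * f (a + w)) ->
  diamond n f a e =
  (1 + im1 * k + (im1 * k) ^+ 2 + (im1 * k) ^+ 3) * edge n f a e.
Proof.
move=> fk; rewrite /diamond -(im1M e).
have -> : - (im1 * e) = im1 * (im1 * (im1 * e)) by rewrite im1M.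
rewrite !(edge_rot _ _ fk); ring.
Qed.

(** Rotation by [im1] multiplies the function by [-1], and the geometric sum over the four edges has
    ratio [- im1]; it vanishes exactly, at every level. *)
Lemma diamond_inv2 n a e : diamond n (fun w => ((w - a) ^+ 2)^-1) a e = 0.
Proof.
rewrite (@diamond_rot n _ (-1) a e).
  have -> : 1 + im1 * -1 + (im1 * -1) ^+ 2 + (im1 * -1) ^+ 3 =
      (1 - im1) * (1 + im1 * im1) :> C R by ring.
  by rewrite im1_sqr subrr mulr0 mul0r.
move=> w; rewrite !(addrC a) !addrK exprMn invfM.
by rewrite expr2 im1_sqr invrN1.
Qed.

(** Here the ratio between successive edges is [im1 * im1^-1 = 1]. *)
Lemma diamond_inv n a e :
  diamond n (fun w => (w - a)^-1) a e = 4 * edge n (fun w => (w - a)^-1) a e.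
Proof.
rewrite (@diamond_rot n _ im1^-1 a e).
  have i0 : im1 != 0 :> C R by rewrite -modc_gt0 modc_im1.
  by rewrite divff//; congr (_ * _); ring.
by move=> w; rewrite !(addrC a) !addrK invfM.
Qed.

Let pt a e (t : R) := a + e * (rc (1 - t) + im1 * rc t).

Let den_gt0 (t : R) : 0 < (1 - t) ^+ 2 + t ^+ 2.
Proof. by nra. Qed.

(** This is the integrand of [dw / w] along the segment from [1] to [im1]; its imaginary part is the
    inverse of [(1 - t) ^+ 2 + t ^+ 2], which is at most 1. *)
Let im_inv (t : R) : 0 <= t <= 1 ->
  1 <= complex.Im ((im1 - 1) / (rc (1 - t) + im1 * rc t)).
Proof.
move=> /andP[t0 t1].
set u := rc _ + _.
have u0 : u != 0.
  have ru : complex.Re u = 1 - t by rewrite /u cReD cReM /=; ring.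
  have iu : complex.Im u = t by rewrite /u cImD cImM /=; ring.
  by apply/eqP => u0; move: ru iu; rewrite u0 /=; lra.
have -> : (im1 - 1) / u =
    rc ((2 * t - 1) / ((1 - t) ^+ 2 + t ^+ 2)) +
    im1 * rc ((1 - t) ^+ 2 + t ^+ 2)^-1.
  apply: (mulIf u0); rewrite mulfVK//.
  have D0 := den_gt0 t.
  apply/eqP; rewrite eq_complex /u /im1 /rc /=; apply/andP; split; apply/eqP.
    by field; rewrite gt_eqF.
  by field; rewrite gt_eqF.
have imp x y : complex.Im (rc x + im1 * rc y : C R) = y.
  by rewrite cImD cImM /=; ring.
by rewrite imp invf_ge1//; nra.
Qed.

(** The integral over this edge is [im1 * pi / 2]. A lower bound uniform in [n] takes its place:
    every trapezoid averages values of imaginary part at least 1. *)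
Lemma edge_inv_ge n a e : e != 0 ->
  1 <= complex.Im (edge n (fun w => (w - a)^-1) a e).
Proof.
move=> e0.
have H t1 t2 : 0 <= t1 -> t1 <= t2 -> t2 <= 1 ->
    t2 - t1 <= complex.Im (trap n (fun w => (w - a)^-1) (pt a e t1) (pt a e t2)).
  elim: n t1 t2 => [|n IH] t1 t2 t10 t12 t21 /=.
    have -> : ((pt a e t1 - a)^-1 + (pt a e t2 - a)^-1) / 2 *
        (pt a e t2 - pt a e t1) =
      rc ((t2 - t1) / 2) * ((im1 - 1) / (rc (1 - t1) + im1 * rc t1) +
        (im1 - 1) / (rc (1 - t2) + im1 * rc t2)).
      rewrite /pt !(addrC a) !addrK !invfM.
      have -> : e * (rc (1 - t2) + im1 * rc t2) + a -
          (e * (rc (1 - t1) + im1 * rc t1) + a) = e * ((im1 - 1) * rc (t2 - t1)).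
        by rewrite !rcB; ring.
      rewrite rcM rcV (_ : rc 2 = 2)//; last by rewrite /rc rmorph_nat.
      set u := (_ + im1 * _)^-1; set v := (_ + im1 * _)^-1; field.
      by [].
    have h1 : 0 <= t1 <= 1 by rewrite t10 (le_trans t12).
    have h2 : 0 <= t2 <= 1 by rewrite t21 (le_trans t10).
    rewrite cImM cImD.
    rewrite [complex.Im (rc _)]/= mul0r addr0 [complex.Re (rc _)]/=.
    have := im_inv h1; have := im_inv h2.
    set x := complex.Im _; set y := complex.Im _ => x1 y1.
    have h3 : 0 <= (t2 - t1) / 2 by lra.
    have h4 : 2 <= x + y by lra.
    by have := ler_wpM2l h3 h4; lra.
  have -> : mid (pt a e t1) (pt a e t2) = pt a e ((t1 + t2) / 2).
    rewrite /mid /pt !(rcB, rcD, rcM) rcV (_ : rc 2 = 2); first by field.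
    by rewrite /rc rmorph_nat.
  rewrite cImD.
  have := IH t1 ((t1 + t2) / 2) t10 ltac:(lra) ltac:(lra).
  have := IH ((t1 + t2) / 2) t2 ltac:(lra) ltac:(lra) t21.
  lra.
have := H 0 1 (lexx _) ler01 (lexx _); rewrite subr0 /pt /edge.
by rewrite !subr0 subrr rc0 rc1 !mulr0 addr0 add0r !mulr1 (mulrC e).
Qed.

Lemma cderiv_quot h a k w : w != a -> (exists d, cderiv h w d) ->
  exists d, cderiv (fun v => h v / (v - a) ^+ k) w d.
Proof.
move=> wa /derivable_cderiv dh; apply/derivable_cderiv.
have dX : derivable (fun v : C R => (v - a) ^+ k) w 1.
  exact: nbhs_singleton (holomorphic_atX w a k).
have w0 : (w - a) ^+ k != 0 by rewrite expf_neq0// subr_eq0.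
have dV := @derivableV _ _ (fun v : C R => (v - a) ^+ k) w 1 w0 dX.
exact: (@derivableM _ _ h (fun v : C R => ((v - a) ^+ k)^-1) w 1 dh dV).
Qed.

(** The second-order remainder [g] is [o(1 / |w - a|)] at [a], so its diamond sums tend to 0. In
    them the term with [h a] contributes nothing, the term with [d] contributes [d * (4 * E)] where
    [E] has modulus at least 1, and the term with [h] at most [32 * M / s]; dividing by 4 gives the
    constant 8. *)
Theorem cauchy_estimate h a d (s M : R) : 0 < s ->
  (forall w, modc (w - a) <= s -> exists d, cderiv h w d) ->
  (forall w, modc (w - a) <= s -> modc (h w) <= M) ->
  cderiv h a d -> modc d <= 8 * M / s.
Proof.
move=> s0 dh hM hd.
pose e := rc s.
have me : modc e = s by rewrite modc_rc gtr0_norm.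
have e0 : e != 0 by rewrite -modc_gt0 me.
pose g w := (h w - h a - d * (w - a)) / (w - a) ^+ 2.
have dg w : w != a -> modc (w - a) <= s -> exists d, cderiv g w d.
  move=> wa ws; apply: cderiv_quot => //; apply/derivable_cderiv.
  have /derivable_cderiv dhw := dh w ws.
  have da : derivable (fun v : C R => d * (v - a)) w 1.
    apply: derivableM; first exact: derivable_cst.
    by apply: derivableB; [exact: derivable_id|exact: derivable_cst].
  apply: derivableB da; apply: derivableB dhw _; exact: derivable_cst.
have g0 (eta : R) : 0 < eta -> exists2 r : R, 0 < r & forall w, w != a ->
    modc (w - a) < r -> modc (g w) * modc (w - a) <= eta.
  move=> eta0; have [r r0 rP] := hd eta eta0; exists r => // w wa wr.
  have wa0 : 0 < modc (w - a) by rewrite modc_gt0 subr_eq0.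
  rewrite /g modcM modcV modcX expr2 invfM -mulrA divfK ?gt_eqF//.
  by rewrite ler_pdivrMr// rP.
apply/ler_addgt0Pr => eta eta0.
have [n /(_ n (leqnn n)) nP] := diamond_cvg0 dg g0 e0 (eq_ind_r (fun x => x <= s) (lexx s) me) eta0.
pose E := edge n (fun w => (w - a)^-1) a e.
have E1 : 1 <= modc E.
  apply: le_trans (edge_inv_ge n a e0) _.
  exact: le_trans (ler_norm _) (Im_le_modc _).
have Eg : diamond n g a e =
    diamond n (fun w => h w / (w - a) ^+ 2) a e - d * (4 * E).
  have eg e' : e' != 0 -> edge n g a e' =
      edge n (fun w => h w / (w - a) ^+ 2) a e' +
      (- h a * edge n (fun w => ((w - a) ^+ 2)^-1) a e' +
       - d * edge n (fun w => (w - a)^-1) a e').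
    move=> e'0; rewrite -!edgeZ -!edgeD; apply: edge_ext => // w wa.
    by rewrite /g; field; rewrite subr_eq0.
  have i0 : im1 * e != 0 by rewrite -modc_gt0 modc_im1M modc_gt0.
  rewrite -diamond_inv -[X in X - _](addr0 _) -(mulr0 (- h a)) -(diamond_inv2 n a e).
  rewrite /diamond !eg ?oppr_eq0//; ring.
have B : modc (diamond n (fun w => h w / (w - a) ^+ 2) a e) <=
    8 * (4 * M / s ^+ 2 * modc e).
  apply: diamond_bound => // w; rewrite me => ws sw.
  have wa0 : 0 < modc (w - a) by lra.
  rewrite modcM modcV modcX ler_pdivrMr ?exprn_gt0//.
  rewrite mulrAC ler_pdivlMr ?exprn_gt0//.
  have := hM w ws; have := modc_ge0 (h w); move: sw s0 wa0.
  set x := modc (w - a); set y := modc (h w) => sw s0 x0 y0 yM.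
  have : s ^+ 2 <= 4 * x ^+ 2 by nra.
  by move: (s ^+ 2) (x ^+ 2) (sqr_ge0 s) (sqr_ge0 x) => S X ? ? ?; nra.
have E2 : 8 * (4 * M / s ^+ 2 * modc e) = 4 * (8 * M / s).
  by rewrite me; field; rewrite gt_eqF.
rewrite {}E2 in B; rewrite {}Eg in nP.
have : modc (d * (4 * E)) <= 4 * (8 * M / s) + eta.
  have := modcB (diamond n (fun w => h w / (w - a) ^+ 2) a e)
    (diamond n (fun w => h w / (w - a) ^+ 2) a e - d * (4 * E)).
  by rewrite opprB addrC subrK; lra.
rewrite !modcM modc_nat; have := modc_ge0 d; move: E1.
move: (modc d) (modc E) (8 * M / s) => x y z y1 x0; nra.
Qed.

End CauchyEstimate.

(** * Consequences of Cauchy's estimate *)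

Section Derivative.
Context {R : realType}.
Implicit Types (z w a b c d e : C R) (f g h : C R -> C R) (P : set (C R)).

Lemma cderivB f g a df dg : cderiv f a df -> cderiv g a dg ->
  cderiv (fun w => f w - g w) a (df - dg).
Proof. by move=> /cderivP ? /cderivP ?; apply/cderivP; exact: is_deriveB. Qed.

Lemma cderivM f g a df dg : cderiv f a df -> cderiv g a dg ->
  cderiv (fun w => f w * g w) a (df * g a + f a * dg).
Proof.
move=> /cderivP fa /cderivP ga; apply/cderivP.
have := @is_deriveM _ _ f g a 1 df dg fa ga.
by rewrite /GRing.scale /= addrC (mulrC (g a)).
Qed.

Lemma cderiv_cst c a : cderiv (fun=> c) a 0.
Proof. by apply/cderivP; exact: is_derive_cst. Qed.

Lemma cderiv_id a : cderiv id a 1.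
Proof. by apply/cderivP; exact: is_derive_id. Qed.

Lemma cderivZ k f a d : cderiv f a d -> cderiv (fun w => k * f w) a (k * d).
Proof. by move=> fd; have := cderivM (cderiv_cst k a) fd; rewrite mul0r add0r. Qed.

Lemma cderivX f a d n : cderiv f a d ->
  cderiv (fun w => f w ^+ n.+1) a (n.+1%:R * f a ^+ n * d).
Proof.
move=> fd; elim: n => [|n IH].
  by rewrite expr0 !mul1r; under eq_fun do rewrite expr1.
have -> : (fun w => f w ^+ n.+2) = (fun w => f w * f w ^+ n.+1).
  by apply/funext => w; rewrite exprS.
have := cderivM fd IH; congr cderiv.
by rewrite (exprS (f a) n) -(natr1 n.+1); ring.
Qed.

Lemma cderiv_shift f a t d : cderiv f (a + t) d ->
  cderiv (fun w => f (w + t)) a d.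
Proof.
move=> fd e e0; have [r r0 rP] := fd e e0; exists r => // w wr.
have wE : w - a = w + t - (a + t) by ring.
by rewrite wE; apply: rP; rewrite -wE.
Qed.

Lemma cderivD f a : derivable f a 1 -> cderiv f a ('D_1 f a).
Proof. by move=> /derivableP /cderivP. Qed.

Lemma cderiv_derivable f a d : cderiv f a d -> derivable f a 1.
Proof. by move=> fd; apply/derivable_cderiv; exists d. Qed.

Lemma holomorphic_at_ball h a : holomorphic_at h a <->
  exists2 r : R, 0 < r & forall w, modc (w - a) < r -> derivable h w 1.
Proof. exact: nbhs_modc. Qed.

(** The real mean value theorem along the segment from [u] to [v], for one real component of [h]:
    [c = 1] selects the real part and [c = - im1] the imaginary part. *)
Lemma re_mean_value (h : C R -> C R) (dh : C R -> C R) c p r L u v :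
  modc c <= 1 ->
  (forall w, modc (w - p) <= r -> cderiv h w (dh w)) ->
  (forall w, modc (w - p) <= r -> modc (dh w) <= L) ->
  modc (u - p) <= r -> modc (v - p) <= r ->
  `|complex.Re (c * (h v - h u) : C R)| <= L * modc (v - u).
Proof.
move=> c1 hd hL up vp.
pose seg (t : R) : C R := u + rc t * (v - u).
have segp (t : R) : 0 <= t <= 1 -> modc (seg t - p) <= r.
  move=> /andP[t0 t1].
  have -> : seg t - p = rc (1 - t) * (u - p) + rc t * (v - p).
    by rewrite /seg rcB rc1; ring.
  apply: le_trans (modcD _ _) _; rewrite !modcM !modc_rc !ger0_norm ?subr_ge0//.
  have t1' : 0 <= 1 - t by rewrite subr_ge0.
  by have := ler_wpM2l t0 vp; have := ler_wpM2l t1' up; lra.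
pose phi t := complex.Re (c * h (seg t) : C R).
pose dphi t := complex.Re (c * (dh (seg t) * (v - u)) : C R).
have phid (t : R) : 0 <= t <= 1 -> is_derive t 1 phi (dphi t).
  move=> t01; have hs := hd _ (segp t t01).
  have cv : x^-1 *: ((phi \o shift t) (x *: 1) - phi t) @[x --> 0^'] --> dphi t.
    apply/cvgrPdist_le => e e0.
    have den : 0 < modc (v - u) + 1 by rewrite ltr_wpDl// modc_ge0.
    have e'0 : 0 < e / (modc (v - u) + 1) by rewrite divr_gt0.
    have [q q0 qP] := hs _ e'0.
    rewrite near_withinE; apply/nbhs_ballP; exists (q / (modc (v - u) + 1)).
      by rewrite /= divr_gt0.
    move=> x; rewrite /ball /= sub0r normrN => xq x0.
    have sx : seg (x *: 1 + t) - seg t = rc x * (v - u).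
      rewrite /seg /GRing.scale /= mulr1 rcD; ring.
    have sxq : modc (seg (x *: 1 + t) - seg t) < q.
      rewrite sx modcM modc_rc.
      move: xq; rewrite ltr_pdivlMr//; apply: le_lt_trans.
      by rewrite ler_wpM2l// lerDl.
    have := qP _ sxq; rewrite sx => H.
    have -> : dphi t - x^-1 *: (phi (x *: 1 + t) - phi t) =
      - complex.Re (c * rc x^-1 * (h (seg (x *: 1 + t)) - h (seg t) -
          dh (seg t) * (rc x * (v - u))) : C R).
      have rcx0 : rc x != 0 by apply: contra_neq x0 => /(congr1 (@complex.Re R)).
      have -> : c * rc x^-1 * (h (seg (x *: 1 + t)) - h (seg t) -
          dh (seg t) * (rc x * (v - u))) =
        rc x^-1 * (c * h (seg (x *: 1 + t)) + - (c * h (seg t))) +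
          - (c * (dh (seg t) * (v - u))).
        by rewrite rcV; field.
      rewrite cReD cReM cReN cReD cReN /phi /dphi /GRing.scale /=; ring.
    rewrite normrN; apply: le_trans (Re_le_modc _) _.
    rewrite !modcM modc_rc normfV.
    apply: (@le_trans _ _ (1 * `|x|^-1 * (e / (modc (v - u) + 1) * modc (rc x * (v - u))))).
      apply: ler_pM => //; last by rewrite ler_wpM2r ?invr_ge0.
      - by rewrite mulr_ge0 ?modc_ge0 ?invr_ge0.
      - exact: modc_ge0.
    rewrite modcM modc_rc mul1r.
    have -> : `|x|^-1 * (e / (modc (v - u) + 1) * (`|x| * modc (v - u))) =
        e * (modc (v - u) / (modc (v - u) + 1)).
      by field; rewrite normr_eq0 x0 gt_eqF.
    by rewrite ler_piMr ?(ltW e0)// ler_pdivrMr// mul1r lerDl.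
  split; first by apply/cvg_ex; exists (dphi t).
  by apply: cvg_lim => //; exact: norm_hausdorff.
have [||t t01] := @MVT_segment R phi dphi 0 1 ler01.
- by move=> t; rewrite in_itv /= => /andP[t0 t1]; apply: phid; rewrite !ltW.
- apply: derivable_within_continuous => t; rewrite in_itv /= => t01.
  by have [] := phid t t01.
rewrite subr0 mulr1 /phi /dphi => E.
have -> : complex.Re (c * (h v - h u) : C R) =
    complex.Re (c * h (seg 1) : C R) - complex.Re (c * h (seg 0) : C R).
  have -> : seg 1 = v by rewrite /seg rc1; ring.
  have -> : seg 0 = u by rewrite /seg rc0; ring.
  by rewrite mulrBr cReD cReN.
rewrite E; apply: le_trans (Re_le_modc _) _; rewrite !modcM.
move: t01; rewrite in_itv /= => t01.
rewrite mulrA ler_wpM2r ?modc_ge0//.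
have := hL _ (segp t t01); have := modc_ge0 (dh (seg t)).
by move: c1 (modc_ge0 c); nra.
Qed.

(** Real and imaginary parts are estimated separately, at intermediate points that may differ; this
    costs the factor 2. *)
Lemma mean_value_ineq (h dh : C R -> C R) p r L u v :
  (forall w, modc (w - p) <= r -> cderiv h w (dh w)) ->
  (forall w, modc (w - p) <= r -> modc (dh w) <= L) ->
  modc (u - p) <= r -> modc (v - p) <= r ->
  modc (h v - h u) <= 2 * L * modc (v - u).
Proof.
move=> hd hL up vp; apply: le_trans (modc_le_ReIm _) _.
have H1 : modc (1 : C R) <= 1 by rewrite modc1.
have H2 : modc (- im1 : C R) <= 1 by rewrite modcN modc_im1.
have := re_mean_value H1 hd hL up vp; have := re_mean_value H2 hd hL up vp.
rewrite mul1r; set x := h v - h u.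
have -> : complex.Re (- im1 * x : C R) = complex.Im x by rewrite cReM /=; lra.
lra.
Qed.

End Derivative.

(** * Lipschitz bounds and the second derivative *)

Section Holomorphic.
Context {R : realType}.
Implicit Types (z w a b c d : C R) (f g h : C R -> C R) (P : set (C R)).

Lemma derivative_bound h a (s M : R) : 0 < s ->
  (forall w, modc (w - a) <= 2 * s -> derivable h w 1) ->
  (forall w, modc (w - a) <= 2 * s -> modc (h w) <= M) ->
  forall w, modc (w - a) <= s -> modc ('D_1 h w) <= 8 * M / s.
Proof.
move=> s0 dh hM w ws.
have wP v : modc (v - w) <= s -> modc (v - a) <= 2 * s.
  by move=> vs; have := modc_tri v w a; lra.
apply: (@cauchy_estimate _ h w _ s M s0).
- by move=> v /wP /dh ?; apply/derivable_cderiv.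
- by move=> v /wP /hM.
- by apply/cderivD/dh/wP; rewrite subrr modc0 ltW.
Qed.

Lemma lipschitz_bound h a (s M : R) : 0 < s ->
  (forall w, modc (w - a) <= 2 * s -> derivable h w 1) ->
  (forall w, modc (w - a) <= 2 * s -> modc (h w) <= M) ->
  forall u v, modc (u - a) <= s -> modc (v - a) <= s ->
  modc (h v - h u) <= 16 * M / s * modc (v - u).
Proof.
move=> s0 dh hM u v us vs.
have -> : 16 * M / s = 2 * (8 * M / s) by ring.
apply: (mean_value_ineq _ _ us vs); last exact: derivative_bound dh hM.
by move=> w ws; apply/cderivD/dh; lra.
Qed.

Lemma holomorphic_bounded h a : holomorphic_at h a ->
  exists2 s : R, 0 < s & exists M : R, forall w, modc (w - a) <= s ->
    derivable h w 1 /\ modc (h w) <= M.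
Proof.
move=> /holomorphic_at_ball[r r0 rP].
have /derivable_cderiv[d hd] : derivable h a 1.
  by apply: rP; rewrite subrr modc0.
have [q q0 qP] := hd 1 ltr01.
exists (Num.min r q / 2); first by rewrite divr_gt0// lt_min r0.
have m0 : 0 < Num.min r q by rewrite lt_min r0.
exists (modc (h a) + (modc d + 1) * q) => w ws.
have wrq : modc (w - a) < Num.min r q by lra.
have wr : modc (w - a) < r by apply: lt_le_trans wrq _; rewrite ge_min lexx.
have wq : modc (w - a) < q by apply: lt_le_trans wrq _; rewrite ge_min lexx orbT.
split; first exact: rP.
have H : modc (h w) <= modc (h a) + (modc d * modc (w - a) + 1 * modc (w - a)).
  have {1}-> : h w = h a + (d * (w - a) + (h w - h a - d * (w - a))) by ring.
  apply: le_trans (modcD _ _) _; rewrite lerD2l.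
  by apply: le_trans (modcD _ _) _; rewrite modcM lerD2l qP.
apply: le_trans H _; rewrite lerD2l -mulrDl ler_wpM2l ?(ltW wq)//.
by rewrite addr_ge0// modc_ge0.
Qed.

Lemma cderiv_lim h a d (e : R) : cderiv h a d -> 0 < e -> exists2 r : R, 0 < r &
  forall t : C R, t != 0 -> modc t < r -> modc ((h (a + t) - h a) / t - d) <= e.
Proof.
move=> hd e0; have [r r0 rP] := hd e e0; exists r => // t t0 tr.
have := rP (a + t); rewrite (addrC a) addrK => /(_ tr) H.
have -> : (h (t + a) - h a) / t - d = (h (t + a) - h a - d * t) / t by field.
by rewrite modcM modcV ler_pdivrMr ?modc_gt0.
Qed.

(** The difference quotients [q t] are holomorphic and bounded by the Lipschitz constant [K] of [h],
    so a second use of Cauchy's estimate makes them Lipschitz uniformly in [t]; the bound survives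
    as [t] tends to 0. *)
Lemma derivative_lipschitz h a : holomorphic_at h a ->
  exists s K : R, [/\ 0 < s, 0 <= K,
    forall w, modc (w - a) <= s -> derivable h w 1 &
    forall u v, modc (u - a) <= s -> modc (v - a) <= s ->
      modc ('D_1 h v - 'D_1 h u) <= K * modc (v - u)].
Proof.
move=> /holomorphic_bounded[s8 s80 [M hM]].
(* The radius is halved three times: [h] is bounded up to [8 * s] and Lipschitz up to [4 * s], the
   quotients are bounded up to [2 * s] (a shift by [t] costs [s]) and Lipschitz up to [s]. *)
have [s s0 sE] : exists2 s : R, 0 < s & s8 = 8 * s.
  by exists (s8 / 8); [rewrite divr_gt0|field].
have M0 : 0 <= M.
  by apply: le_trans (modc_ge0 (h a)) (hM a _).2; rewrite subrr modc0 ltW.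
have dh w : modc (w - a) <= 8 * s -> derivable h w 1.
  by rewrite -sE => /hM[].
have s40 : 0 < 4 * s by rewrite mulr_gt0.
pose K := 16 * M / (4 * s).
have hL u v : modc (u - a) <= 4 * s -> modc (v - a) <= 4 * s ->
    modc (h v - h u) <= K * modc (v - u).
  apply: lipschitz_bound => // w ws; first by apply: dh; lra.
  by apply: (hM _ _).2; lra.
have K0 : 0 <= K by rewrite divr_ge0 ?mulr_ge0// ltW.
pose q (t : C R) w := t^-1 * (h (w + t) - h w).
have qd t w : modc t <= s -> modc (w - a) <= 2 * s ->
    cderiv (q t) w (t^-1 * ('D_1 h (w + t) - 'D_1 h w)).
  move=> ts ws; apply: cderivZ; apply: cderivB.
    apply: cderiv_shift; apply/cderivD/dh.
    by have := modc_tri (w + t) w a; rewrite (addrC w) addrK; lra.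
  by apply/cderivD/dh; lra.
have qK t w : t != 0 -> modc t <= s -> modc (w - a) <= 2 * s -> modc (q t w) <= K.
  move=> t0 ts ws; rewrite /q modcM modcV mulrC ler_pdivrMr ?modc_gt0//.
  have := hL w (w + t); rewrite (addrC w t) addrK; apply; first lra.
  by have := modc_tri (t + w) w a; rewrite addrK; lra.
pose K' := 16 * K / s.
have K'0 : 0 <= K' by apply: divr_ge0; [exact: mulr_ge0|exact: ltW].
have qL t u v : t != 0 -> modc t <= s -> modc (u - a) <= s -> modc (v - a) <= s ->
    modc (q t v - q t u) <= K' * modc (v - u).
  move=> t0 ts; apply: lipschitz_bound => // w ws; last exact: qK.
  exact: cderiv_derivable (qd _ _ ts ws).
exists s, K'; split => // [w ws|u v us vs]; first by apply: dh; lra.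
apply/ler_addgt0Pr => e e0; have e20 : 0 < e / 2 by rewrite divr_gt0.
have us8 : modc (u - a) <= 8 * s by lra.
have vs8 : modc (v - a) <= 8 * s by lra.
have [r1 r10 r1P] := cderiv_lim (cderivD (dh u us8)) e20.
have [r2 r20 r2P] := cderiv_lim (cderivD (dh v vs8)) e20.
pose t : C R := rc (Num.min (Num.min r1 r2) s / 2).
have m0 : 0 < Num.min (Num.min r1 r2) s by rewrite !lt_min r10 r20.
have tm : modc t < Num.min (Num.min r1 r2) s.
  by rewrite modc_rc gtr0_norm; lra.
have t0 : t != 0 by rewrite -modc_gt0 modc_rc gtr0_norm; lra.
move: tm; rewrite !lt_min => /andP[/andP[tr1 tr2] ts].
have := r1P t t0 tr1; have := r2P t t0 tr2; have := qL t u v t0 (ltW ts) us vs.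
rewrite /q !(mulrC t^-1).
set x := _ / t; set y := _ / t => H1 H2 H3.
rewrite modc_distC in H2.
apply: le_trans (modc_tri _ x _) _; rewrite [e]splitr addrCA.
apply: lerD H2 _; apply: le_trans (modc_tri _ y _) _; exact: lerD.
Qed.

(** The derivative of [q t] at [a] is the difference quotient [rat t] of ['D_1 h]. As [q t - q u] is
    of order [modc t + modc u] near [a], Cauchy's estimate shows that [rat] is Cauchy as [t] tends
    to 0; its limit is found as a cluster point in a compact ball. *)
Lemma derivative_derivable h a : holomorphic_at h a -> derivable ('D_1 h) a 1.
Proof.
move=> /derivative_lipschitz[s [K [s0 K0 dh dL]]].
have [s2 s20 sE] : exists2 s2 : R, 0 < s2 & s = 2 * s2.
  by exists (s / 2); [rewrite divr_gt0|field].
pose q (t : C R) w := t^-1 * (h (w + t) - h w).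
have qd t w : modc t <= s2 -> modc (w - a) <= s2 ->
    cderiv (q t) w (t^-1 * ('D_1 h (w + t) - 'D_1 h w)).
  move=> ts ws; apply: cderivZ; apply: cderivB.
    apply: cderiv_shift; apply/cderivD/dh.
    by have := modc_tri (w + t) w a; rewrite (addrC w) addrK; lra.
  by apply/cderivD/dh; lra.
have qh t w : t != 0 -> modc t <= s2 -> modc (w - a) <= s2 ->
    modc (q t w - 'D_1 h w) <= 2 * K * modc t.
  move=> t0 ts ws.
  have P v : modc (v - w) <= modc t -> modc (v - a) <= s.
    by move=> vt; have := modc_tri v w a; lra.
  (* With its linear part at [w] removed, [h] has derivative at most [K * modc t] on the ball of
     radius [modc t]. *)
  have H := @mean_value_ineq _ (fun v => h v - 'D_1 h w * v)
    (fun v => 'D_1 h v - 'D_1 h w * 1) w (modc t) (K * modc t) w (w + t).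
  have -> : q t w - 'D_1 h w = (h (w + t) - 'D_1 h w * (w + t) -
      (h w - 'D_1 h w * w)) / t by rewrite /q; field.
  rewrite modcM modcV ler_pdivrMr ?modc_gt0//.
  have E : modc (w + t - w) = modc t by rewrite (addrC w) addrK.
  rewrite E (mulrA 2) in H; apply: H.
  - move=> v /P vs; apply: cderivB; first exact/cderivD/dh.
    by apply: cderivZ; exact: cderiv_id.
  - move=> v vt; rewrite mulr1; apply: le_trans (dL _ _ _ (P _ vt)) _.
      by lra.
    by rewrite ler_wpM2l.
  - by rewrite subrr modc0 modc_ge0.
  - by [].
have qq t u : t != 0 -> modc t <= s2 -> u != 0 -> modc u <= s2 ->
    modc (t^-1 * ('D_1 h (a + t) - 'D_1 h a) -
          u^-1 * ('D_1 h (a + u) - 'D_1 h a)) <=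
    8 * (2 * K * (modc t + modc u)) / s2.
  move=> t0 ts u0 us.
  apply: (@cauchy_estimate _ (fun w => q t w - q u w) a _ s2 _ s20).
  - move=> w ws; eexists; apply: cderivB; exact: qd.
  - move=> w ws; have := qh t w t0 ts ws; have := qh u w u0 us ws.
    have := modc_tri (q t w) ('D_1 h w) (q u w).
    rewrite (modc_distC ('D_1 h w) (q u w)); lra.
  - by apply: cderivB; apply: qd; rewrite // subrr modc0 ltW.
pose rat u := u^-1 * ('D_1 h (a + u) - 'D_1 h a).
pose F := rat @ ((0 : C R)^').
have FP : ProperFilter F by exact: fmap_proper_filter.
have FB : F [set w | modc (w - 0) <= K].
  apply/dnbhs_modc; exists s => // u u0; rewrite !subr0 => us.
  rewrite /= subr0 /rat modcM modcV mulrC ler_pdivrMr ?modc_gt0//.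
  have := dL a (a + u); rewrite (addrC a u) addrK; apply; last exact: ltW.
  by rewrite subrr modc0 ltW.
have [l [_ lP]] := @compact_ball_modc _ 0 K F FP FB.
have tl t : t != 0 -> modc t <= s2 -> modc (rat t - l) <= 16 * K / s2 * modc t.
  move=> t0 ts; apply/ler_addgt0Pr => e e0.
  pose c := 16 * K / s2; have c0 : 0 <= c by apply: divr_ge0; [exact: mulr_ge0|exact: ltW].
  pose e' := e / 2 / (c + 1).
  have c1 : 0 < c + 1 by lra.
  have e'0 : 0 < e' by rewrite divr_gt0// divr_gt0.
  have [||w [[u [u0 us ue] <-] wl]] := lP
      [set rat u | u in [set u | [/\ u != 0, modc u <= s2 & modc u < e']]]
      [set w | modc (w - l) < e / 2].
  - apply/dnbhs_modc; exists (Num.min s2 e'); first by rewrite lt_min s20.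
    move=> u u0; rewrite subr0 lt_min => /andP[us ue].
    by exists u => //; split => //; exact: ltW.
  - by apply/nbhs_modc; exists (e / 2) => //; rewrite divr_gt0.
  have H := qq t u t0 ts u0 us; rewrite -/(rat t) -/(rat u) in H.
  have cE : 8 * (2 * K * (modc t + modc u)) / s2 = c * (modc t + modc u).
    by rewrite /c; field; rewrite gt_eqF.
  rewrite cE in H; rewrite -/c; move: wl => /= wl.
  have cu : c * modc u <= e / 2.
    apply: le_trans (ler_wpM2l c0 (ltW ue)) _.
    rewrite /e' mulrA ler_pdivrMr// mulrC ler_wpM2l//; first by rewrite divr_ge0// ltW.
    by rewrite lerDl.
  apply: le_trans (modc_tri _ (rat u) _) _; rewrite [e]splitr addrA.
  apply: lerD (ltW wl); apply: le_trans H _; by rewrite mulrDr lerD2l.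
apply/derivable_cderiv; exists l => e e0.
pose c := 16 * K / s2; have c0 : 0 <= c by apply: divr_ge0; [exact: mulr_ge0|exact: ltW].
have c1 : 0 < c + 1 by lra.
exists (Num.min s2 (e / (c + 1))); first by rewrite lt_min s20 divr_gt0.
move=> w; rewrite lt_min => /andP[ws we].
have [->|wa] := eqVneq w a; first by rewrite !subrr mulr0 subr0 modc0 mulr0.
have wa0 : w - a != 0 by rewrite subr_eq0.
have := tl _ wa0 (ltW ws); rewrite /rat (addrC a) subrK -/c => H.
have -> : 'D_1 h w - 'D_1 h a - l * (w - a) =
    ((w - a)^-1 * ('D_1 h w - 'D_1 h a) - l) * (w - a).
  by rewrite mulrBl mulrAC mulVf// mul1r.
rewrite modcM ler_wpM2r ?modc_ge0//; apply: le_trans H _.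
apply: le_trans (ler_wpM2l c0 (ltW we)) _.
by rewrite mulrA ler_pdivrMr// mulrC ler_wpM2l ?lerDl// ltW.
Qed.

End Holomorphic.

(** * Removal of the singularity of a slope, and a derivative bound *)

Section Local.
Context {R : realType}.
Implicit Types (z w a b c d : C R) (f g h : C R -> C R) (P : set (C R)).

Definition slope_at h a w := if w == a then 'D_1 h a else (h w - h a) / (w - a).

(** The point [a] itself is the issue: the derivative there is [l / 2], with [l] the second
    derivative of [h], by the mean value inequality for the second Taylor remainder [F], whose
    derivative [G] is [o(|u - a|)]. *)
Lemma holomorphic_at_slope h a : holomorphic_at h a ->
  holomorphic_at (slope_at h a) a.
Proof.
move=> hol; have [r r0 dh] := (holomorphic_at_ball h a).1 hol.
apply: (holomorphic_at_ball (slope_at h a) a).2; exists r; first exact: r0.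
move=> w wr.
have [->|wa] := eqVneq w a; last first.
  have hw : derivable (fun v => (h v - h a) / (v - a) ^+ 1) w 1.
    have [d hd] : exists d, cderiv (fun v => (h v - h a) / (v - a) ^+ 1) w d.
      apply: (@cderiv_quot _ (fun v => h v - h a)) => //.
      exists ('D_1 h w - 0); apply: cderivB; last exact: cderiv_cst.
      exact/cderivD/dh.
    exact: cderiv_derivable hd.
  apply: near_eq_derivable hw; apply/nbhs_modc.
  exists (modc (w - a)); first by rewrite modc_gt0 subr_eq0.
  move=> v vw; rewrite /slope_at ifN ?expr1//.
  by apply: contraTneq vw => ->; rewrite modc_distC ltxx.
have [l hl] := (derivable_cderiv _ _).1 (derivative_derivable hol).
apply/derivable_cderiv; exists (l / 2) => e e0.
have e20 : 0 < e / 2 by rewrite divr_gt0.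
have [q q0 qP] := hl _ e20.
exists (Num.min r q); first by rewrite lt_min r0.
move=> v; rewrite lt_min => /andP[vr vq].
have [->|va] := eqVneq v a; first by rewrite !subrr mulr0 subr0 modc0 mulr0.
rewrite /slope_at eqxx (negbTE va).
have va0 : 0 < modc (v - a) by rewrite modc_gt0 subr_eq0.
pose F u := h u - h a - 'D_1 h a * (u - a) - l / 2 * (u - a) ^+ 2.
pose G u := 'D_1 h u - 0 - 'D_1 h a * (1 - 0) -
  l / 2 * (2%:R * (u - a) ^+ 1 * (1 - 0)).
have -> : (h v - h a) / (v - a) - 'D_1 h a - l / 2 * (v - a) =
   (F v - F a) / (v - a).
  by rewrite /F; move: ('D_1 h a) => x; field; rewrite subr_eq0.
rewrite modcM modcV ler_pdivrMr//.
have -> : e * modc (v - a) * modc (v - a) =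
  2 * (e / 2 * modc (v - a)) * modc (v - a) by field.
apply: (@mean_value_ineq _ F G a (modc (v - a))); last 2 first.
- by rewrite subrr modc0 modc_ge0.
- exact: lexx.
- move=> u uv; apply: cderivB; first apply: cderivB; first apply: cderivB.
  + exact/cderivD/dh/(le_lt_trans uv).
  + exact: cderiv_cst.
  + apply: cderivZ.
    by apply: cderivB; [exact: cderiv_id|exact: cderiv_cst].
  + apply: cderivZ; apply: (@cderivX _ (fun u => u - a)).
    by apply: cderivB; [exact: cderiv_id|exact: cderiv_cst].
- move=> u uv; rewrite /G expr1 !subr0 !mulr1.
  have -> : 'D_1 h u - 'D_1 h a - l / 2 * (2%:R * (u - a)) =
     'D_1 h u - 'D_1 h a - l * (u - a).
    by move: ('D_1 h u - 'D_1 h a) => x; field.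
  apply: le_trans (qP u (le_lt_trans uv vq)) _.
  by rewrite ler_wpM2l// ltW.
Qed.

Lemma bernoulli (x : R) n : 0 <= x <= 1 -> 1 - n%:R * x <= (1 - x) ^+ n.
Proof.
move=> /andP[x0 x1]; elim: n => [|n IH]; first by rewrite mul0r subr0 expr0.
rewrite exprS -natr1.
have x1' : 0 <= 1 - x by rewrite subr_ge0.
have := ler_wpM2l x1' IH; have : 0 <= n%:R * x * x by rewrite !mulr_ge0.
lra.
Qed.

(* Cauchy's estimate for the power [h ^+ n] with [n] of the order of
   [(1 - |h w|)^-1]. *)
Lemma derivative_le_defect h a (s : R) : 0 < s ->
  (forall w, modc (w - a) <= 2 * s -> derivable h w 1 /\ modc (h w) <= 1) ->
  forall w, modc (w - a) <= s ->
  modc ('D_1 h w) <= 32 / s * (1 - modc (h w)).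
Proof.
move=> s0 hP w ws.
have wP v : modc (v - w) <= s -> derivable h v 1 /\ modc (h v) <= 1.
  by move=> vs; apply: hP; have := modc_tri v w a; lra.
have [dw hw1] : derivable h w 1 /\ modc (h w) <= 1.
  by apply: wP; rewrite subrr modc0 ltW.
apply/ler_addgt0Pr => e e0.
set v := 1 - modc (h w).
have v0 : 0 <= v by rewrite subr_ge0.
have v1 : v <= 1 by rewrite lerBlDr lerDl modc_ge0.
(* A positive majorant of the defect [v]. With [n] about [(2 * V)^-1], Bernoulli's inequality keeps
   [(1 - v) ^+ n] above 1/2 while [n.+1] is still large enough to bound the derivative by
   [32 / s * V]. *)
pose V := v + e * s / 32.
have V0 : 0 < V by rewrite ltr_wpDl// divr_gt0// mulr_gt0.
have V20 : 0 <= (2 * V)^-1 by rewrite invr_ge0 mulr_ge0// ltW.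
have [n /andP[n1 n2]] : exists n : nat, n%:R <= (2 * V)^-1 < n.+1%:R.
  by exists (Num.truncn (2 * V)^-1); exact: truncn_itv.
have H : modc (n.+1%:R * h w ^+ n * 'D_1 h w) <= 8 * 1 / s.
  apply: (@cauchy_estimate _ (fun u => h u ^+ n.+1) w) => //.
  - move=> u /wP[du _]; eexists; apply: cderivX; exact: cderivD.
  - move=> u /wP[_ hu]; by rewrite modcX exprn_ile1 ?modc_ge0.
  - exact: (@cderivX _ h w _ n (cderivD dw)).
move: H; rewrite !modcM modc_nat modcX mulr1.
have hE : modc (h w) = 1 - v by rewrite /v opprB addrCA subrr addr0.
rewrite hE => H.
have B : 2^-1 <= (1 - v) ^+ n.
  apply: le_trans (bernoulli n _); last by rewrite v0.
  have : n%:R * V <= 2^-1.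
    have := ler_wpM2r (ltW V0) n1; rewrite invfM mulfVK// gt_eqF//.
  have : n%:R * v <= n%:R * V by rewrite ler_wpM2l// lerDl divr_ge0// mulr_ge0// ltW.
  move: (n%:R * v) (n%:R * V) => x y; lra.
have d0 := modc_ge0 ('D_1 h w); move: d0 H; set d := modc _ => d0 H.
have : n.+1%:R * 2^-1 * d <= 8 / s.
  by apply: le_trans H; rewrite ler_wpM2r// ler_wpM2l.
move=> H2.
have H3 : (2 * V)^-1 * 2^-1 * d <= 8 / s.
  by apply: le_trans H2; rewrite ler_wpM2r// ler_wpM2r ?invr_ge0// ltW.
have -> : 32 / s * v + e = 8 / s * (4 * V) by rewrite /V; field; rewrite gt_eqF.
have -> : d = (2 * V)^-1 * 2^-1 * d * (4 * V) by field; rewrite gt_eqF.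
by rewrite ler_wpM2r// mulr_ge0// ltW.
Qed.

End Local.

(** * The maximum modulus principle and division by zeros *)

Section MaxModulus.
Context {R : realType}.
Implicit Types (z w a b c d : C R) (f g h k : C R -> C R).

Lemma holomorphic_atZ b h a : holomorphic_at h a ->
  holomorphic_at (fun w => b * h w) a.
Proof.
apply: filterS => w hw; exact: cderiv_derivable (cderivZ b (cderivD hw)).
Qed.

Lemma half_expn_lt (e : R) : 0 < e -> exists m : nat, 2^-1 ^+ m < e.
Proof.
move=> e0; have : (fun m : nat => 2^-1 ^+ m) @ \oo --> (0 : R).
  by apply: cvg_expr; rewrite ger0_norm ?invr_ge0// invf_lt1// ltr1n.
by move=> /cvgr_lt /(_ _ e0)[m _ mP]; exists m; exact: mP (leqnn m).
Qed.

(** The defect [1 - modc (h w)] bounds the derivative, and the derivative bounds the change of [h]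
    from [h a = 1], hence the defect. On a small disc each round halves the bound, so the defect is
    0. *)
Lemma max_modulus1 h a : holomorphic_at h a -> h a = 1 ->
  (\forall w \near a, modc (h w) <= 1) -> \forall w \near a, modc (h w) = 1.
Proof.
move=> /holomorphic_at_ball[r1 r10 r1P] ha1 /nbhs_modc[r2 r20 r2P].
have [s s0 sP] : exists2 s : R, 0 < s & forall w, modc (w - a) <= 2 * s ->
    derivable h w 1 /\ modc (h w) <= 1.
  have m0 : 0 < Num.min r1 r2 by rewrite lt_min r10.
  exists (Num.min r1 r2 / 4); first by rewrite divr_gt0.
  move=> w ws; have : modc (w - a) < Num.min r1 r2 by lra.
  by rewrite lt_min => /andP[w1 w2]; split; [exact: r1P|exact: r2P].
(* The two bounds together multiply by [2 * (32 / s)], which on radius [s / 128] amounts to 1/2. *)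
pose t := s / 128; have t0 : 0 < t by rewrite divr_gt0.
have ts w : modc (w - a) <= t -> modc (w - a) <= s by rewrite /t; lra.
have aa : modc (a - a) <= t by rewrite subrr modc0 ltW.
have iter_half n w : modc (w - a) <= t -> 1 - modc (h w) <= 2^-1 ^+ n.
  elim: n w => [|n IH] w wt; first by rewrite expr0 lerBlDr lerDl modc_ge0.
  have D u : modc (u - a) <= t -> modc ('D_1 h u) <= 32 / s * 2^-1 ^+ n.
    move=> ut; apply: le_trans (derivative_le_defect s0 sP (ts _ ut)) _.
    by rewrite ler_wpM2l ?divr_ge0 ?(ltW s0)// IH.
  have H : modc (h w - h a) <= 2 * (32 / s * 2^-1 ^+ n) * modc (w - a).
    apply: (@mean_value_ineq _ h ('D_1 h) a t) => // u ut.
    by apply: cderivD; apply: (sP _ _).1; have := ts _ ut; lra.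
  have : 1 <= modc (h w) + modc (h w - h a).
    rewrite -[leLHS]modc1 -ha1 modc_distC.
    by have := modcD (h w) (h a - h w); rewrite addrC subrK.
  move: H; set x : R := 2^-1 ^+ n => H H1.
  have x0 : 0 <= x by rewrite exprn_ge0// invr_ge0.
  have : 2 * (32 / s * x) * modc (w - a) <= 2 * (32 / s * x) * t.
    by rewrite ler_wpM2l// !mulr_ge0 ?invr_ge0// ltW.
  have -> : 2 * (32 / s * x) * t = x / 2 by rewrite /t; field; rewrite gt_eqF.
  rewrite (exprS _ n) -/x; move: H1 H.
  set y := 2 * _ * _; set m := modc (h w); set m' := modc (_ - _).
  clearbody x y m m'; lra.
apply/nbhs_modc; exists t => // w wt.
have wt' := ltW wt.
apply/eqP; rewrite eq_le (sP _ _).2 /=; last by have := ts _ wt'; lra.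
rewrite -subr_le0; apply/ler_addgt0Pr => e e0; rewrite add0r.
have [n ne] := half_expn_lt e0.
exact: le_trans (iter_half n w wt') (ltW ne).
Qed.

Lemma max_modulus h a : holomorphic_at h a ->
  (\forall w \near a, modc (h w) <= modc (h a)) ->
  \forall w \near a, modc (h w) = modc (h a).
Proof.
move=> hh hle; have [ha0|ha0] := eqVneq (h a) 0.
  move: hle; apply: filterS => w; rewrite ha0 modc0 => hw.
  by apply/eqP; rewrite eq_le hw modc_ge0.
have m0 : 0 < modc (h a) by rewrite modc_gt0.
have := @max_modulus1 (fun w => (h a)^-1 * h w) a (holomorphic_atZ _ hh).
rewrite mulVf// => /(_ erefl) H.
have {}H : \forall w \near a, modc ((h a)^-1 * h w) = 1.
  apply: H; move: hle; apply: filterS => w hw.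
  by rewrite modcM modcV mulrC ler_pdivrMr// mul1r.
move: H; apply: filterS => w; rewrite modcM modcV => /(congr1 ( *%R (modc (h a)))).
by rewrite mulVKf ?gt_eqF// mulr1.
Qed.

Lemma holomorphic_continuous h a : holomorphic_at h a -> h w @[w --> a] --> h a.
Proof.
move=> /nbhs_singleton dh; apply: differentiable_continuous.
exact/derivable1_diffP.
Qed.

Lemma holomorphic_eq_at f g a : holomorphic_at f a -> holomorphic_at g a ->
  (\forall w \near a^', f w = g w) -> f a = g a.
Proof.
move=> hf hg fg.
have fa : f @ a^' --> f a.
  exact: (@cvg_within_filter _ _ f (nbhs a) _ (nbhs (f a)) _ (holomorphic_continuous hf)).
have ga : g @ a^' --> g a.
  exact: (@cvg_within_filter _ _ g (nbhs a) _ (nbhs (g a)) _ (holomorphic_continuous hg)).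
apply: (cvg_unique (@norm_hausdorff _ _) fa).
apply: cvg_trans ga; apply: near_eq_cvg.
by move: fg; apply: filterS => w ->.
Qed.

Lemma holomorphic_at_cst b a : holomorphic_at (fun=> b) a.
Proof. by rewrite /holomorphic_at; near=> w; exact: derivable_cst. Unshelve. all: by end_near. Qed.

Lemma dnbhs_neq a : \forall w \near a^', w != a.
Proof. by apply/dnbhs_modc; exists 1. Qed.

(** A zero of [h] at [a] can be divided out at most [n] times, as each division lowers the exponent
    on the right; at exponent 0 the product is 1 and [h a] cannot vanish. *)
Lemma factor_order h k a n : holomorphic_at h a -> holomorphic_at k a ->
  (\forall w \near a^', h w * k w = (w - a) ^+ n) ->
  exists j g, [/\ holomorphic_at g a, g a != 0 &
    \forall w \near a^', h w = (w - a) ^+ j * g w].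
Proof.
move=> + hk; elim: n h => [|n IH] h hh hkE.
  exists 0%N, h; split => //; last first.
    by near=> w; rewrite expr0 mul1r.
  have := @holomorphic_eq_at (fun w => h w * k w) (fun w => 1) a
    (holomorphic_atM hh hk) (holomorphic_at_cst 1 a).
  have H : \forall w \near a^', h w * k w = 1.
    by move: hkE; apply: filterS => w; rewrite expr0.
  move=> /(_ H) E; apply: contraTneq (oner_neq0 (C R)) => h0.
  by rewrite -E h0 mul0r eqxx.
have [ha|ha] := eqVneq (h a) 0; last first.
  by exists 0%N, h; split => //; near=> w; rewrite expr0 mul1r.
have slopeE : \forall w \near a^', h w = (w - a) * slope_at h a w.
  move: (dnbhs_neq a); apply: filterS => w wa.
  by rewrite /slope_at (negbTE wa) ha subr0 mulrC divfK// subr_eq0.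
have [||j [g [hg g0 gE]]] := IH (slope_at h a).
- exact: holomorphic_at_slope.
- near=> w; have wa : w - a != 0.
    by rewrite subr_eq0; near: w; exact: dnbhs_neq.
  apply: (mulfI wa); rewrite mulrA -exprS.
  have <- : h w = (w - a) * slope_at h a w by near: w.
  by near: w.
exists j.+1, g; split => //; near=> w.
have -> : h w = (w - a) * slope_at h a w by near: w.
by rewrite exprS -mulrA; congr (_ * _); near: w.
Unshelve. all: by end_near. Qed.

End MaxModulus.

(** * The maximum principle on a Riemann surface *)

Section Surface.
Context {R : realType} {B : riemannSurface R}.
Implicit Types (k : B -> C R) (p q : B) (c : chart R B).

Lemma nbhs_chart_img c p : chart_dom c p -> \forall w \near c p, (c @` chart_dom c) w.
Proof.
by move=> cp; apply: open_nbhs_nbhs; split; [exact: open_chart_img|exists p].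
Qed.

Lemma nbhs_chart_dom c p : chart_dom c p -> \forall q \near p, chart_dom c q.
Proof. by move=> cp; apply: open_nbhs_nbhs; split => //; exact: open_chart_dom. Qed.

Lemma nbhs_chart c p (P : B -> Prop) : chart_dom c p ->
  (\forall q \near p, P q) <-> (\forall w \near c p, P (chart_inv c w)).
Proof.
move=> cp; split=> [H|H].
- by apply: (chart_inv_continuous cp); rewrite /= chart_mapK.
- have H' := chart_continuous cp H; have dc := nbhs_chart_dom cp.
  have {}H' : \forall q \near p, P (chart_inv c (c q)) by exact: H'.
  by move: H' dc; apply: filterS2 => q + cq; rewrite chart_mapK.
Qed.

Definition hol_at k p := forall c, atlas c -> chart_dom c p ->
  holomorphic_at (fun w => k (chart_inv c w)) (c p).

Lemma hol_at_continuous k p : hol_at k p -> {for p, continuous k}.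
Proof.
move=> hk; have [c ac cp] := atlas_cover p.
move=> A; rewrite /= => nA.
have := holomorphic_continuous (hk c ac cp).
rewrite /= chart_mapK// => /(_ A nA) H.
exact: (nbhs_chart (k @^-1` A) cp).2 H.
Qed.

Lemma hol_at_sub k p (a : C R) : hol_at k p -> hol_at (fun q => k q - a) p.
Proof.
move=> hk c ac cp; exact: holomorphic_atD (hk c ac cp) (holomorphic_at_cst (- a) _).
Qed.

Lemma continuous_modc (T : topologicalType) (f : T -> C R) (p : T) :
  {for p, continuous f} -> {for p, continuous (modc \o f)}.
Proof.
move=> cf A /nbhs_ballP[e e0 eA].
have H : nbhs (f p) [set w | modc (w - f p) < e] by apply/nbhs_modc; exists e.
have H' : \forall q \near p, modc (f q - f p) < e by exact: (cf _ H).
move: H'; apply: filterS => q /= qe; apply: eA; rewrite /ball /=.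
apply: le_lt_trans qe; rewrite ler_norml lerBlDr lerBrDr.
have := modcD (f q - f p) (f p); rewrite subrK.
have := modcD (f p - f q) (f q); rewrite subrK (modc_distC (f p)).
by move=> H1 H2; apply/andP; split; lra.
Qed.

Lemma hol_at_max k p : hol_at k p ->
  (\forall q \near p, modc (k q) <= modc (k p)) ->
  \forall q \near p, modc (k q) = modc (k p).
Proof.
move=> hk H; have [c ac cp] := atlas_cover p.
apply/(nbhs_chart _ cp); have := max_modulus (hk c ac cp).
rewrite /= chart_mapK//; apply.
exact: (nbhs_chart (fun q => modc (k q) <= modc (k p)) cp).1 H.
Qed.

Lemma clopen_setT (A : set B) : A !=set0 -> open A -> closed A -> A = setT.
Proof.
move=> A0 oA cA; apply: (@rs_connected _ B) => //; first by exists A; rewrite ?setTI.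
by exists A; rewrite ?setTI.
Qed.

Lemma compact_max_modc (A : set B) k : compact A -> A !=set0 ->
  (forall p, A p -> {for p, continuous k}) ->
  exists2 p, A p & forall q, A q -> modc (k q) <= modc (k p).
Proof.
move=> cA A0 kc.
have [|p /set_mem Ap H] := @compact_EVT_max B R (modc \o k) A A0 cA.
  apply: continuous_in_subspaceT => p /set_mem Ap.
  exact: continuous_modc (kc _ Ap).
by exists p => // q Aq; apply: H; exact: mem_set.
Qed.

Hypothesis compactB : compact [set: B].

(** Maximum modulus and connectedness make the modulus constant. Applied to [k - k p], which
    vanishes at [p], this makes [k] itself constant. *)
Lemma hol_at_compact_const k : (forall p, hol_at k p) -> exists a, forall p, k p = a.
Proof.
move=> hk.
have kmax l : (forall p, hol_at l p) -> exists m, forall p, modc (l p) = m.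
  move=> hl.
  have [p _ pM] := compact_max_modc compactB (rs_nonempty B)
    (fun p _ => hol_at_continuous (hl p)).
  exists (modc (l p)) => q.
  suff /seteqP[_ /(_ q I)//] : [set q | modc (l q) = modc (l p)] = setT.
  apply: clopen_setT; first by exists p.
    rewrite openE => q' /= qE; rewrite /interior /= -qE.
    by apply: hol_at_max => //; apply: nearW => q''; rewrite qE; exact: pM.
  have cl : continuous (modc \o l).
    by move=> x; exact: continuous_modc (hol_at_continuous (hl x)).
  have := (@closed_comp _ _ (modc \o l) [set modc (l p)]); apply.
    by move=> x _; exact: cl.
  exact: accessible_closed_set1 (hausdorff_accessible (@norm_hausdorff _ _)) _.
have [p _] := rs_nonempty B.
have [m mP] := kmax (fun q => k q - k p) (fun q => hol_at_sub (k p) (hk q)).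
exists (k p) => q; apply/eqP; rewrite -subr_eq0 -modc_eq0 mP -(mP p).
by rewrite subrr modc0.
Qed.

(** A maximum above [m] over the compact [closure N] would be attained only inside [N], on a set
    that is open and closed, hence equal to [B]. *)
Lemma hol_at_max_principle k (N : set B) (m : R) : open N -> N <> setT ->
  (forall p, N p -> hol_at k p) ->
  (forall p, closure N p -> {for p, continuous k}) ->
  (forall p, closure N p -> ~ N p -> modc (k p) <= m) ->
  forall p, N p -> modc (k p) <= m.
Proof.
move=> oN NT hk ck km p Np.
have cN : compact (closure N).
  by apply: (subclosed_compact _ compactB) => //; exact: closed_closure.
have N0 : closure N !=set0 by exists p; exact: subset_closure.
have [p0 cp0 p0M] := compact_max_modc cN N0 ck.
apply: le_trans (p0M p (subset_closure Np)) _.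
rewrite leNgt; apply/negP => mM.
have inN q : closure N q -> modc (k q) = modc (k p0) -> N q.
  move=> cq qE; apply: contrapT => nN.
  by have := km q cq nN; rewrite qE leNgt mM.
apply: NT; pose A := [set q | closure N q /\ modc (k q) = modc (k p0)].
have AT : A = setT.
  apply: clopen_setT; first by exists p0.
    rewrite openE => q [cq qE]; have Nq := inN q cq qE.
    have nN : \forall x \near q, N x by apply: open_nbhs_nbhs.
    have H : \forall x \near q, modc (k x) = modc (k q).
      apply: hol_at_max; first exact: hk.
      by apply: filterS nN => x Nx; rewrite qE; apply: p0M; exact: subset_closure.
    apply: filterS2 nN H => x Nx xq; split; first exact: subset_closure.
    by rewrite xq qE.
  rewrite -[X in closed X]setCK; apply: open_closedC; rewrite openE => q nA.
  have [cq|ncq] := pselect (closure N q); last first.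
    have : nbhs q (~` closure N).
      by apply: open_nbhs_nbhs; split => //; exact/closed_openC/closed_closure.
    by apply: filterS => x ncx [].
  have oM : nbhs ((modc \o k) q) (~` [set modc (k p0)]).
    apply: open_nbhs_nbhs; split; last by move=> /= qE; apply: nA.
    exact/closed_openC/accessible_closed_set1/hausdorff_accessible/norm_hausdorff.
  have H : \forall x \near q, modc (k x) <> modc (k p0).
    exact: (continuous_modc (ck q cq) oM).
  by move: H; apply: filterS => x xne [_].
apply/seteqP; split => // q _.
have [cq qE] : A q by rewrite AT.
exact: inN.
Qed.

End Surface.

(** * Orders of units *)

Section HolomorphicClosure.
Context {R : realType}.
Implicit Types (a : C R) (f g h : C R -> C R).

Lemma holomorphic_at_near f g a : (\forall w \near a, f w = g w) ->
  holomorphic_at g a -> holomorphic_at f a.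
Proof.
move=> /near_join fg; apply: filterS2 fg => w fg hg.
by apply: near_eq_derivable hg; move: fg; apply: filterS => v ->.
Qed.

Lemma holomorphic_neq0 h a : holomorphic_at h a -> h a != 0 ->
  \forall w \near a, h w != 0.
Proof.
move=> hh h0; have m0 : 0 < modc (h a) by rewrite modc_gt0.
have H : nbhs (h a) [set v | v != 0].
  apply/nbhs_modc; exists (modc (h a)) => // v vh.
  by apply: contraTneq vh => ->; rewrite sub0r modcN ltxx.
exact: (holomorphic_continuous hh H).
Qed.

Lemma holomorphic_atV h a : holomorphic_at h a -> h a != 0 ->
  holomorphic_at (fun w => (h w)^-1) a.
Proof.
move=> hh h0; apply: filterS2 hh (holomorphic_neq0 hh h0) => w dw w0.
exact: derivableV.
Qed.

Lemma holomorphic_at_exprn h a n : holomorphic_at h a ->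
  holomorphic_at (fun w => h w ^+ n) a.
Proof.
move=> hh; elim: n => [|n IH].
  by apply: holomorphic_at_near (holomorphic_at_cst 1 a); near=> w; rewrite expr0.
apply: holomorphic_at_near (holomorphic_atM hh IH); near=> w; exact: exprS.
Unshelve. all: by end_near. Qed.

Lemma holomorphic_at_exprz h a (m : int) : holomorphic_at h a -> h a != 0 ->
  holomorphic_at (fun w => h w ^ m) a.
Proof.
move=> hh h0; case: m => n; first exact: holomorphic_at_exprn.
by apply: holomorphic_atV; [exact: holomorphic_at_exprn|exact: expf_neq0].
Qed.

Lemma holomorphic_near g a (P : C R -> Prop) : holomorphic_at g a ->
  (\forall v \near g a, P v) -> \forall w \near a, P (g w).
Proof. by move=> hg; exact: (holomorphic_continuous hg). Qed.

Lemma holomorphic_at_comp f g a : holomorphic_at g a -> holomorphic_at f (g a) ->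
  holomorphic_at (fun w => f (g w)) a.
Proof.
move=> hg hf.
have hf' : \forall w \near a, derivable f (g w) 1.
  exact: (@holomorphic_near g a (fun v => derivable f v 1)).
apply: filterS2 hg hf' => w /derivable1_diffP dg /derivable1_diffP df.
by apply/derivable1_diffP; exact: (differentiable_comp dg df).
Qed.

End HolomorphicClosure.

(** * Local orders in charts *)

Section ChartOrder.
Context {R : realType} {B : riemannSurface R}.
Local Notation K := (functionField B).
Implicit Types (x y : K) (p q : B) (c : chart R B).

(** Elements of the function field are normalized: where a limit exists, it is the value. An
    equality off [p] with a continuous function therefore extends to [p]. *)
Lemma ff_chart_eq x p c (g : C R -> C R) : chart_dom c p ->
  holomorphic_at g (c p) ->
  (\forall w \near (c p)^', x (chart_inv c w) = g w) ->
  \forall w \near c p, x (chart_inv c w) = g w.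
Proof.
move=> cp hg H.
have cK : \forall w \near c p, c (chart_inv c w) = w.
  by apply: filterS (nbhs_chart_img cp) => w [q cq <-]; rewrite chart_mapK.
have xg : \forall q \near p^', x q = g (c q).
  apply/(near_chart _ cp); move: H; rewrite !near_withinE.
  by apply: filterS2 cK => w cw xw wp; rewrite xw// cw.
have cv : x q @[q --> p^'] --> g (c p).
  have cg : g (c q) @[q --> p] --> g (c p).
    exact: (cvg_comp _ _ (chart_continuous cp) (holomorphic_continuous hg)).
  have cg' : g (c q) @[q --> p^'] --> g (c p).
    exact: (@cvg_within_filter _ _ (fun q => g (c q)) (nbhs p) _ (nbhs (g (c p))) _ cg).
  apply: cvg_trans cg'; apply: near_eq_cvg.
  by move: xg; apply: filterS => q ->.
have xp : x p = g (c p).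
  rewrite -(ff_normal x) /normalize ifT; last first.
    by apply/asboolP/cvg_ex; exists (g (c p)).
  apply: (@cvg_lim _ _ _ _ (rs_dnbhs_proper p)) cv; exact: norm_hausdorff.
move: H; rewrite near_withinE; apply: filterS => w xw.
by have [->|/xw//] := eqVneq w (c p); rewrite chart_mapK.
Qed.

Lemma ff_hol_at x p : (forall c, atlas c -> chart_dom c p ->
    exists2 g, holomorphic_at g (c p) &
      \forall w \near (c p)^', x (chart_inv c w) = g w) -> hol_at x p.
Proof.
move=> H c ac cp; have [g hg xg] := H c ac cp.
exact: holomorphic_at_near (ff_chart_eq cp hg xg) hg.
Qed.

Lemma hol_at_mulE x y p : hol_at x p -> hol_at y p ->
  hol_at (x * y) p /\ (x * y) p = x p * y p.
Proof.
move=> hx hy.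
have H c : atlas c -> chart_dom c p ->
    \forall w \near c p, (x * y) (chart_inv c w) =
      x (chart_inv c w) * y (chart_inv c w).
  move=> ac cp; apply: (ff_chart_eq cp (holomorphic_atM (hx c ac cp) (hy c ac cp))).
  exact: (near_chart _ cp).1 (ff_mulE x y p).
split.
  move=> c ac cp.
  exact: holomorphic_at_near (H c ac cp) (holomorphic_atM (hx c ac cp) (hy c ac cp)).
have [c ac cp] := atlas_cover p.
by have := nbhs_singleton (H c ac cp); rewrite chart_mapK.
Qed.

Lemma ff_one p : (1 : K) p = 1.
Proof.
have [c ac cp] := atlas_cover p.
have H := ff_chart_eq cp (holomorphic_at_cst 1 (c p))
  ((near_chart _ cp).1 (ff_ofE (meromorphic_cst 1) p)).
by have := nbhs_singleton H; rewrite chart_mapK.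
Qed.

Definition chart_order c p x (m : int) := exists h : C R -> C R,
  [/\ holomorphic_at h (c p), h (c p) != 0 &
    \forall w \near (c p)^', x (chart_inv c w) = (w - c p) ^ m * h w].

Lemma unit_chart_order x y p c : x * y = 1 -> atlas c -> chart_dom c p ->
  exists m, chart_order c p x m.
Proof.
move=> xy ac cp.
have [n [h [hh xh]]] := ff_meromorphic x ac cp.
have [n' [h' [hh' yh]]] := ff_meromorphic y ac cp.
have xy1 : \forall w \near (c p)^', x (chart_inv c w) * y (chart_inv c w) = 1.
  apply: (near_chart (fun q => x q * y q = 1) cp).1.
  by apply: filterS (ff_mulE x y p) => q <-; rewrite -[ff_mul x y]/(x * y) xy ff_one.
have hhE : \forall w \near (c p)^', h w * h' w = (w - c p) ^+ (n + n').
  near=> w.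
  have w0 : w - c p != 0 by rewrite subr_eq0; near: w; exact: dnbhs_neq.
  have : x (chart_inv c w) * y (chart_inv c w) = 1 by near: w.
  have -> : x (chart_inv c w) = h w / (w - c p) ^+ n by near: w; exact: xh.
  have -> : y (chart_inv c w) = h' w / (w - c p) ^+ n' by near: w; exact: yh.
  rewrite mulf_divX => E; apply: (mulIf (invr_neq0 (expf_neq0 (n + n') w0))).
  by rewrite E mulfV// expf_neq0.
have [j [g [hg g0 hE]]] := factor_order hh hh' hhE.
exists (j%:Z - n%:Z), g; split => //; near=> w.
have w0 : w - c p != 0 by rewrite subr_eq0; near: w; exact: dnbhs_neq.
have -> : x (chart_inv c w) = h w / (w - c p) ^+ n by near: w; exact: xh.
have -> : h w = (w - c p) ^+ j * g w by near: w; exact: hE.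
by rewrite expfzDr// -invr_expz mulrAC.
Unshelve. all: by end_near. Qed.

Lemma transition_holomorphic c1 c2 p : atlas c1 -> atlas c2 ->
  chart_dom c1 p -> chart_dom c2 p ->
  holomorphic_at (fun w => c2 (chart_inv c1 w)) (c1 p).
Proof.
move=> a1 a2 p1 p2.
have d2 := (nbhs_chart _ p1).1 (nbhs_chart_dom p2).
apply: filterS2 (nbhs_chart_img p1) d2 => w [q q1 <-]; rewrite chart_mapK// => q2.
exact: atlas_holomorphic.
Qed.

(** The change of coordinates [tau] is the coordinate at [c2 p] times [kap], up to constants; [kap]
    does not vanish at [c2 p] because its product with the slope of the inverse change [sig] is 1.
    So [kap ^ m] can be absorbed into the nonvanishing factor. *)
Lemma chart_order_transition c1 c2 p x m : atlas c1 -> atlas c2 ->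
  chart_dom c1 p -> chart_dom c2 p -> chart_order c1 p x m -> chart_order c2 p x m.
Proof.
move=> a1 a2 p1 p2 [g [hg g0 xg]].
pose tau w := c1 (chart_inv c2 w); pose sig w := c2 (chart_inv c1 w).
have htau : holomorphic_at tau (c2 p) by exact: transition_holomorphic.
have hsig : holomorphic_at sig (c1 p) by exact: transition_holomorphic.
have tau_p : tau (c2 p) = c1 p by rewrite /tau chart_mapK.
have sig_p : sig (c1 p) = c2 p by rewrite /sig chart_mapK.
have d1 := (nbhs_chart _ p2).1 (nbhs_chart_dom p1).
have img2 := nbhs_chart_img p2.
have ktau : \forall w \near c2 p, chart_inv c1 (tau w) = chart_inv c2 w.
  by apply: filterS d1 => w dw; rewrite /tau chart_mapK.
have sigtau : \forall w \near c2 p, sig (tau w) = w.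
  apply: filterS2 ktau img2 => w; rewrite /sig => -> [q q2 <-].
  by rewrite chart_mapK.
have tauN : \forall w \near (c2 p)^', tau w != c1 p.
  rewrite near_withinE; apply: filterS sigtau => w st wp.
  by apply: contra_neq wp => tw; rewrite -st tw sig_p.
pose kap := slope_at tau (c2 p).
have hkap : holomorphic_at kap (c2 p) by exact: holomorphic_at_slope.
have kapE : \forall w \near (c2 p)^', tau w - c1 p = (w - c2 p) * kap w.
  apply: filterS (dnbhs_neq (c2 p)) => w wp.
  by rewrite /kap /slope_at (negbTE wp) tau_p mulrC divfK// subr_eq0.
have kap0 : kap (c2 p) != 0.
  pose kap' := slope_at sig (c1 p).
  have hkt : holomorphic_at (fun w => kap' (tau w)) (c2 p).
    have H := @holomorphic_at_comp R kap' tau (c2 p) htau.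
    by rewrite tau_p in H; exact: (H (holomorphic_at_slope hsig)).
  have H1 : \forall w \near (c2 p)^', kap w * kap' (tau w) = 1.
    near=> w.
    have w0 : w - c2 p != 0 by rewrite subr_eq0; near: w; exact: dnbhs_neq.
    have t0 : tau w != c1 p by near: w.
    apply: (mulfI w0); rewrite mulrA mulr1.
    have <- : tau w - c1 p = (w - c2 p) * kap w by near: w.
    rewrite /kap' /slope_at (negbTE t0) sig_p mulrC divfK ?subr_eq0//.
    by congr (_ - _); near: w; exact: nbhs_dnbhs.
  have := holomorphic_eq_at (holomorphic_atM hkap hkt) (holomorphic_at_cst 1 _) H1.
  by move=> /= E; apply: contraTneq (oner_neq0 (C R)) => k0; rewrite -E k0 mul0r eqxx.
exists (fun w => kap w ^ m * g (tau w)); split.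
- apply: holomorphic_atM; first exact: holomorphic_at_exprz.
  have H := @holomorphic_at_comp R g tau (c2 p) htau.
  by rewrite tau_p in H; exact: (H hg).
- by rewrite mulf_neq0 ?expfz_neq0// tau_p.
have xg' : \forall w \near c2 p, tau w != c1 p ->
    x (chart_inv c1 (tau w)) = (tau w - c1 p) ^ m * g (tau w).
  move: xg; rewrite near_withinE -tau_p => xg.
  by have := holomorphic_continuous htau xg; rewrite tau_p.
near=> w.
have -> : chart_inv c2 w = chart_inv c1 (tau w).
  by symmetry; near: w; exact: nbhs_dnbhs.
have tw : tau w != c1 p by near: w.
have -> : x (chart_inv c1 (tau w)) = (tau w - c1 p) ^ m * g (tau w).
  by move: tw; near: w; exact: nbhs_dnbhs.
have -> : tau w - c1 p = (w - c2 p) * kap w by near: w.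
by rewrite expfzMl mulrA.
Unshelve. all: by end_near. Qed.

(** [val] is an [xget] over all orders; once some order exists, the chosen integer is itself an
    order, and inequalities on [val] become statements in charts. *)
Lemma unit_has_order x y p : x * y = 1 -> exists2 m, has_order p x m & Defs.val p x = m%:E%E.
Proof.
move=> xy; have [c ac cp] := atlas_cover p.
have [m mP] := unit_chart_order xy ac cp.
have x0 : x != 0 by apply: contraTneq (oner_neq0 K) => x0; rewrite -xy x0 mul0r eqxx.
have om : has_order p x m.
  by move=> c' ac' cp'; exact: chart_order_transition ac ac' cp cp' mP.
exists (xget 0 [set m | has_order p x m]).
  by apply: (@xgetPex _ 0 [set m | has_order p x m]); exists m.
by rewrite /Defs.val (negbTE x0).
Qed.

Lemma order_ge0_hol_at x p (m : int) : has_order p x m -> 0 <= m -> hol_at x p.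
Proof.
move=> xm; case: m xm => // n xn _; apply: ff_hol_at => c ac cp.
have [h [hh _ xh]] := xn c ac cp.
exists (fun w => (w - c p) ^+ n * h w); last exact: xh.
exact: holomorphic_atM (holomorphic_atX (c p) (c p) n) hh.
Qed.

Lemma order_le0_hol_at_inv x y p (m : int) : x * y = 1 ->
  has_order p x m -> m <= 0 -> hol_at y p.
Proof.
move=> xy xm m0; apply: (@order_ge0_hol_at y p (- m)); last by rewrite oppr_ge0.
move=> c ac cp; have [h [hh h0 xh]] := xm c ac cp.
exists (fun w => (h w)^-1); split; [exact: holomorphic_atV|exact: invr_neq0|].
have xy1 : \forall w \near (c p)^', x (chart_inv c w) * y (chart_inv c w) = 1.
  apply: (near_chart (fun q => x q * y q = 1) cp).1.
  by apply: filterS (ff_mulE x y p) => q <-; rewrite -[ff_mul x y]/(x * y) xy ff_one.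
near=> w.
have E : x (chart_inv c w) * y (chart_inv c w) = 1 by near: w.
have -> : y (chart_inv c w) = (x (chart_inv c w))^-1.
  by apply: (@mulfI _ (x (chart_inv c w))); rewrite ?E ?mulfV//;
    apply: contraTneq (oner_neq0 (C R)) => x0; rewrite -E x0 mul0r eqxx.
have -> : x (chart_inv c w) = (w - c p) ^ m * h w by near: w.
by rewrite invfM invr_expz.
Unshelve. all: by end_near. Qed.

Lemma unit_hol_at_or_inv x y p : x * y = 1 -> hol_at x p \/ hol_at y p.
Proof.
move=> xy; have [m xm _] := unit_has_order p xy.
have [m0|m0] := leP 0 m; first by left; exact: order_ge0_hol_at xm m0.
by right; exact: order_le0_hol_at_inv xy xm (ltW m0).
Qed.

Lemma regular_unit_hol_at (A : set B) x y p : x * y = 1 -> regular_off A x ->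
  ~ A p -> hol_at x p.
Proof.
move=> xy xA pA; have [m xm vm] := unit_has_order p xy.
by apply: order_ge0_hol_at xm _; have := xA p pA; rewrite vm lee_fin.
Qed.

End ChartOrder.

(** * Equicontinuity *)

(* [compact_cover] would do, but it is only available on pointed spaces. *)
Lemma compact_finite_subcover (T : topologicalType) (L : set T) (E : T -> set T) :
  compact L -> (forall p, L p -> nbhs p (E p)) ->
  exists l : seq T, (forall p, p \in l -> L p) /\
    forall q, L q -> exists2 p, p \in l & E p q.
Proof.
move=> /compact_near_coveringP cL LE.
(* The filter of properties shared by all sufficiently large finite lists of points of [L]. *)
pose F (A : set (seq T)) := exists2 l0 : seq T, (forall p, p \in l0 -> L p) &
  forall l : seq T, (forall p, p \in l -> L p) -> {subset l0 <= l} -> A l.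
have FF : Filter F.
  split.
  - by exists [::].
  - move=> P Q [l0 L0 Pl] [l1 L1 Ql]; exists (l0 ++ l1).
      by move=> p; rewrite mem_cat => /orP[/L0|/L1].
    move=> l lL ll; split; [apply: Pl|apply: Ql] => // p pl; apply: ll.
      by rewrite mem_cat pl.
    by rewrite mem_cat pl orbT.
  - by move=> P Q PQ [l0 L0 Pl]; exists l0 => // l lL ll; apply/PQ/Pl.
have [|l0 L0 H] := cL _ F (fun (l : seq T) q => exists2 p, p \in l & E p q) FF.
  move=> p Lp; exists (E p, [set l : seq T | p \in l]); first split => /=.
  - exact: LE.
  - exists [:: p] => [q|l _]; first by rewrite inE => /eqP ->.
    by apply; rewrite mem_head.
  - by move=> [q l] [/= Eq pl]; exists p.
by exists l0; split => // q Lq; apply: (H l0).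
Qed.

Section Equicontinuity.
Context {R : realType} {B : riemannSurface R}.
Local Notation K := (functionField B).
Implicit Types (x y : K) (p q : B) (c : chart R B).

Definition bounded_hol (O : set B) (M : R) (k : B -> C R) :=
  forall q, O q -> hol_at k q /\ modc (k q) <= M.

(** The Lipschitz constant given by Cauchy's estimate depends on [M] and on a radius in a chart at
    [p], so one neighbourhood serves all [k]. *)
Lemma bounded_hol_equicontinuous (O : set B) (M d : R) p : open O -> O p -> 0 < d ->
  \forall q \near p, forall k, bounded_hol O M k -> modc (k q - k p) <= d.
Proof.
move=> oO Op d0; have [c ac cp] := atlas_cover p.
apply: (nbhs_chart (fun q => forall k, bounded_hol O M k -> modc (k q - k p) <= d) cp).2.
have nO : \forall q \near p, O q by apply: open_nbhs_nbhs.
have /nbhs_modc[r r0 rP] :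
    \forall w \near c p, (c @` chart_dom c) w /\ O (chart_inv c w).
  by apply: filterI; [exact: nbhs_chart_img|exact: (nbhs_chart O cp).1 nO].
have [s s0 sr] : exists2 s : R, 0 < s & 2 * s < r by exists (r / 4); lra.
pose L := 16 * `|M| / s.
have L0 : 0 <= L by apply: divr_ge0; [exact: mulr_ge0|exact: ltW].
have L1 : 0 < L + 1 by rewrite ltr_wpDl.
apply/nbhs_modc; exists (Num.min s (d / (L + 1))).
  by rewrite lt_min s0 divr_gt0.
move=> w; rewrite lt_min => /andP[ws wd] k kP.
have dk v : modc (v - c p) <= 2 * s -> derivable (fun w => k (chart_inv c w)) v 1.
  move=> vs; have [[q cq qv] Ov] := rP v (le_lt_trans vs sr).
  have [hk _] := kP _ Ov.
  rewrite -qv chart_mapK// in hk; have := nbhs_singleton (hk c ac cq).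
  by rewrite qv.
have kM v : modc (v - c p) <= 2 * s -> modc (k (chart_inv c v)) <= `|M|.
  move=> vs; have [_ Ov] := rP v (le_lt_trans vs sr).
  exact: le_trans (kP _ Ov).2 (ler_norm _).
have cc : modc (c p - c p) <= s by rewrite subrr modc0 ltW.
have := lipschitz_bound s0 dk kM cc (ltW ws).
rewrite chart_mapK// -/L => /le_trans; apply.
apply: le_trans (ler_wpM2l L0 (ltW wd)) _.
by rewrite mulrA ler_pdivrMr// mulrC ler_wpM2l ?lerDl// ltW.
Qed.

(** Total boundedness as a finite colouring, here by the index of the cell of length [d] in
    [[- M, M]]; a colouring leads to finiteness by pigeonhole, without extracting subsequences. *)
Lemma real_code (M d : R) : 0 < d -> exists (T : finType) (g : R -> T),
  forall a b : R, `|a| <= M -> `|b| <= M -> g a = g b -> `|a - b| <= d.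
Proof.
move=> d0; pose N := Num.truncn (2 * M / d).
exists 'I_N.+1, (fun a => inord (Num.truncn ((a + M) / d))) => a b.
rewrite !ler_norml => /andP[a1 a2] /andP[b1 b2].
have H (t : R) : - M <= t -> t <= M -> (Num.truncn ((t + M) / d) < N.+1)%N /\
    (Num.truncn ((t + M) / d))%:R <= (t + M) / d <
    (Num.truncn ((t + M) / d)).+1%:R.
  move=> t1 t2; have t0 : 0 <= (t + M) / d by apply: divr_ge0; [lra|exact: ltW].
  split; last exact: truncn_itv.
  rewrite ltnS; apply: le_truncn; rewrite ler_pM2r ?invr_gt0//; lra.
have [aN /andP[a3 a4]] := H a a1 a2; have [bN /andP[b3 b4]] := H b b1 b2.
move=> /(congr1 val); rewrite /= !inordK// => ab.
rewrite ab in a3 a4; move: a3 a4 b3 b4.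
rewrite ler_pdivlMr// ltr_pdivrMr// ler_pdivlMr// ltr_pdivrMr//.
rewrite -natr1 => a3 a4 b3 b4; apply/andP; split; lra.
Qed.

Lemma points_code (F : set K) (M d : R) (s : seq B) : 0 < d ->
  (forall x p, F x -> p \in s -> modc (x p) <= M) ->
  exists (T : finType) (g : K -> T), forall x y, F x -> F y -> g x = g y ->
    forall p, p \in s -> modc (x p - y p) <= d.
Proof.
move=> d0; elim: s => [|p s IH] FM; first by exists unit, (fun=> tt).
have [|T [g gP]] := IH; first by move=> x q Fx qs; apply: FM; rewrite // in_cons qs orbT.
have d20 : 0 < d / 2 by rewrite divr_gt0.
have [T' [g' g'P]] := real_code M d20.
exists (T * (T' * T'))%type,
  (fun x => (g x, (g' (complex.Re (x p)), g' (complex.Im (x p))))).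
move=> x y Fx Fy [gxy rxy ixy] q; rewrite in_cons => /predU1P[->|]; last exact: gP.
have xM : modc (x p) <= M by apply: FM; rewrite // mem_head.
have yM : modc (y p) <= M by apply: FM; rewrite // mem_head.
apply: le_trans (modc_le_ReIm _) _; rewrite [leRHS]splitr cReD cImD cReN cImN.
apply: lerD; apply: g'P => //.
- exact: le_trans (Re_le_modc _) xM.
- exact: le_trans (Re_le_modc _) yM.
- exact: le_trans (Im_le_modc _) xM.
- exact: le_trans (Im_le_modc _) yM.
Qed.

(** The Arzela-Ascoli argument: by equicontinuity, values at finitely many points of [L], known up
    to [d / 3], determine a member of [F] on [L] up to [d]. *)
Lemma totally_bounded_on_compact (F : set K) (O L : set B) (M d : R) : 0 < d ->
  open O -> compact L -> L `<=` O -> (forall x, F x -> bounded_hol O M x) ->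
  exists (T : finType) (g : K -> T), forall x y, F x -> F y -> g x = g y ->
    forall q, L q -> modc (x q - y q) <= d.
Proof.
move=> d0 oO cL LO FO; have d30 : 0 < d / 3 by rewrite divr_gt0.
pose E p := [set q | forall k, bounded_hol O M k -> modc (k q - k p) <= d / 3].
have [l [lL Ll]] : exists l : seq B, (forall p, p \in l -> L p) /\
    forall q, L q -> exists2 p, p \in l & E p q.
  apply: compact_finite_subcover cL _ => p Lp.
  exact: (bounded_hol_equicontinuous M oO (LO _ Lp) d30).
have [|T [g gP]] := @points_code F M (d / 3) l d30.
  by move=> x p Fx /lL /LO Op; exact: (FO x Fx p Op).2.
exists T, g => x y Fx Fy gxy q Lq; have [p pD Eq] := Ll q Lq.
have H1 := Eq x (FO x Fx); have H2 := Eq y (FO y Fy).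
have H3 := gP x y Fx Fy gxy p pD.
apply: le_trans (modc_tri _ (x p) _) _.
have := modc_tri (x p) (y p) (y q).
rewrite (modc_distC (y p)); lra.
Qed.

End Equicontinuity.

(** * Finiteness *)

Section Discs.
Context {R : realType} {B : riemannSurface R}.

Lemma closed_disc_center (p : B) D : closed_disc p D -> D p.
Proof.
by move=> [phi [_ _ <- <- _]]; exists 0; rewrite // /unit_disc /= normr0 ler01.
Qed.

Lemma closed_disc_closed (p : B) D : closed_disc p D -> closed D.
Proof.
move=> [phi [cphi _ _ <- _]]; apply: (@compact_closed B _ (@rs_hausdorff R B)).
apply: continuous_compact cphi _.
have -> : unit_disc = [set w : C R | modc (w - 0) <= 1].
  by apply/seteqP; split => w; rewrite /unit_disc /= subr0 modcE -rc1 rc_le.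
exact: compact_ball_modc.
Qed.

Lemma disjoint_discs_closed (S U : set B) : finite_set S -> disjoint_discs S U ->
  closed U.
Proof.
move=> fS [D [DS _ ->]]; apply: closed_bigcup => // s Ss.
exact: closed_disc_closed (DS s Ss).
Qed.

End Discs.

(** * Rigidity of units close to 1 *)

Section Rigidity.
Context {R : realType} {B : riemannSurface R}.
Local Notation K := (functionField B).
Implicit Types (x y : K) (p q : B).

Lemma ff_constM (a b : C R) : ff_const a * ff_const b = ff_const (a * b) :> K.
Proof.
apply: ff_ext => p; apply: filterS3 (ff_mulE (ff_const a) (ff_const b) p)
  (ff_ofE (meromorphic_cst (a * b)) p)
  (filterI (ff_ofE (meromorphic_cst a) p) (ff_ofE (meromorphic_cst b) p)).
by move=> q -> -> [-> ->].
Qed.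

Lemma ff_const_ext x a : (forall p, x p = a) -> x = ff_const a.
Proof.
move=> xa; apply: ff_ext => p.
by apply: filterS (ff_ofE (meromorphic_cst a) p) => q ->.
Qed.

Lemma hol_at_mul1 x y p : x * y = 1 -> hol_at x p -> hol_at y p -> x p * y p = 1.
Proof. by move=> xy hx hy; rewrite -(hol_at_mulE hx hy).2 xy ff_one. Qed.

Lemma hol_at_inverse x y p : x * y = 1 -> hol_at x p -> x p != 0 -> hol_at y p.
Proof.
move=> xy hx x0; apply: ff_hol_at => c ac cp.
have hc := hx c ac cp.
have xc0 : x (chart_inv c (c p)) != 0 by rewrite chart_mapK.
exists (fun w => (x (chart_inv c w))^-1); first exact: holomorphic_atV.
have xy1 : \forall w \near (c p)^', x (chart_inv c w) * y (chart_inv c w) = 1.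
  apply: (near_chart (fun q => x q * y q = 1) cp).1.
  by apply: filterS (ff_mulE x y p) => q <-; rewrite -[ff_mul x y]/(x * y) xy ff_one.
have xn0 : \forall w \near (c p)^', x (chart_inv c w) != 0.
  exact: nbhs_dnbhs (holomorphic_neq0 hc xc0).
by apply: filterS2 xy1 xn0 => w E w0; apply: (mulfI w0); rewrite E mulfV.
Qed.

Hypothesis compactB : compact [set: B].

Lemma hol_unit_const x y : x * y = 1 -> (forall p, hol_at x p) ->
  exists2 a, a != 0 & x = ff_const a /\ y = ff_const a^-1.
Proof.
move=> xy hx; have [a xa] := hol_at_compact_const compactB hx.
have xE := ff_const_ext xa.
have a0 : a != 0.
  apply: contraTneq (oner_neq0 K) => a0; rewrite -xy xE a0.
  by rewrite -[ff_const 0]/(0 : K) mul0r eqxx.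
exists a => //; split => //.
have aa : ff_const a^-1 * x = 1 by rewrite xE ff_constM mulVf.
by rewrite -[LHS]mul1r -aa -mulrA xy mulr1.
Qed.

(* Near 1 on the boundary of [N s], whose only point in [S] is [s], a unit [f]
   has neither a zero nor a pole at [s] by the maximum principle applied to
   [f - 1] or to [f^-1 - 1]; if [N s] is all of [B] there is no boundary, but
   then [s] is the only possible zero or pole. *)
Lemma unit_near1_const (S : set B) (N : B -> set B) (f g : K) : f * g = 1 ->
  (forall p, ~ S p -> hol_at f p /\ hol_at g p) ->
  (forall s, S s -> open (N s) /\ N s s) ->
  (forall s q, S s -> S q -> closure (N s) q -> q = s) ->
  (forall s q, S s -> closure (N s) q -> ~ N s q -> modc (f q - 1) <= 4^-1) ->
  exists2 a, a != 0 & f = ff_const a.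
Proof.
move=> fg fgS NS NS1 fN; have gf : g * f = 1 by rewrite mulrC.
have [[s Ss NT]|noT] := pselect (exists2 s, S s & N s = setT).
  have only q : q <> s -> ~ S q.
    by move=> qs Sq; apply: qs; apply: NS1 Ss Sq _; rewrite NT closureT.
  case: (unit_hol_at_or_inv s fg) => hs.
    have [|a a0 [fa _]] := hol_unit_const fg; last by exists a.
    by move=> q; have [->//|/only /fgS[]] := pselect (q = s).
  have [|a a0 [_ fa]] := hol_unit_const gf; last by exists a^-1; rewrite ?invr_eq0.
  by move=> q; have [->//|/only /fgS[]] := pselect (q = s).
have [|a a0 [fa _]] := hol_unit_const fg; last by exists a.
move=> s; have [Ss|/fgS[]//] := pselect (S s).
have [hs|hs] := unit_hol_at_or_inv s fg; first exact: hs.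
have [oN Nss] := NS s Ss.
have NT : N s <> setT by move=> NT; apply: noT; exists s.
have hg q : closure (N s) q -> hol_at g q.
  have [Sq /(NS1 _ _ Ss Sq) -> //|/fgS[]//] := pselect (S q).
(* On the boundary [modc (f q)] is at least 3/4, so [g - 1 = (1 - f) * g] is at most [1/4 * 4/3]
   there; a bound below 1 at [s] excludes a zero of [g], that is, a pole of [f]. *)
have g1 : modc (g s - 1) <= 3^-1.
  apply: (@hol_at_max_principle R B compactB (fun q => g q - 1) (N s)) => //.
  - move=> q /subset_closure /hg; exact: hol_at_sub.
  - by move=> q /hg hq; apply: hol_at_continuous; exact: hol_at_sub.
  - move=> q cq nq; have fq := fN s q Ss cq nq.
    have nSq : ~ S q by move=> Sq; apply: nq; rewrite (NS1 _ _ Ss Sq cq).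
    have [hfq hgq] := fgS q nSq.
    have fgq := hol_at_mul1 fg hfq hgq.
    have fge : 3 / 4 <= modc (f q).
      have := modcD (f q) (1 - f q); rewrite addrC subrK modc1.
      by rewrite (modc_distC 1); lra.
    have f0 : 0 < modc (f q) by lra.
    have -> : g q - 1 = (1 - f q) * g q by rewrite mulrBl mul1r fgq.
    rewrite modcM modc_distC.
    have := congr1 modc fgq; rewrite modcM modc1.
    have := modc_ge0 (g q); have := modc_ge0 (f q - 1).
    move: fq fge; move: (modc (f q)) (modc (g q)) (modc (f q - 1)) => u v w.
    move=> w1 u1 w0 v0 uv; have v1 : v <= 4 / 3 by nra.
    nra.
apply: hol_at_inverse gf hs _; rewrite -modc_gt0.
have := modcD (g s) (1 - g s); rewrite addrC subrK modc1 (modc_distC 1).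
move: g1; set u := modc _; set v := modc _; lra.
Qed.

End Rigidity.

(** * Bounded units modulo constants *)

Section Finiteness.
Context {R : realType} {B : riemannSurface R}.
Local Notation K := (functionField B).

Lemma regular_unitsP (S : set B) (x : K) : regular_units S x ->
  x * x^-1 = 1 /\ forall p, ~ S p -> hol_at x p /\ hol_at (x^-1)%R p.
Proof.
move=> [xS [x' x'S xx']].
have xu : x \is a GRing.unit by apply/unitrP; exists x'; rewrite mulrC xx'.
have xV : x^-1 = x' by rewrite -[LHS]mulr1 -xx' mulKr.
split; first exact: divrr.
move=> p pS; rewrite xV; split; first exact: regular_unit_hol_at xx' xS pS.
by apply: regular_unit_hol_at x'S pS; rewrite mulrC; exact: xx'.
Qed.

Lemma class_mod_constants_eq (a : C R) (x y : K) : a != 0 -> x = ff_const a * y ->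
  class_mod_constants x = class_mod_constants y.
Proof.
move=> a0 ->; apply/seteqP; split => z [b b0 <-].
  by exists (b * a); [exact: mulf_neq0|rewrite -ff_constM mulrA].
exists (b / a); first by rewrite /= mulf_neq0// invr_eq0.
by rewrite mulrA ff_constM divfK.
Qed.

Theorem bounded_units_finite (S U V : set B) (eps : R) : compact [set: B] ->
  finite_set S -> disjoint_discs S U -> closed V -> V `<=` ~` U -> 0 < eps ->
  finite_set (@class_mod_constants R B @` bounded_units S (~` (U `|` V)) eps).
Proof.
move=> compactB finS dU cV VU eps0.
have cU := disjoint_discs_closed finS dU.
set O := ~` (U `|` V).
have oO : open O by apply: closed_openC; exact: closedU.
have [D [DS tD UE]] := dU.
have SU s : S s -> U s.
  by move=> Ss; rewrite UE; exists s => //; exact: closed_disc_center (DS s Ss).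
have SO q : O q -> ~ S q by move=> Oq /SU Uq; apply: Oq; left.
have [N NP] : {N : B -> set B & forall s, S s ->
    [/\ open (N s), D s `<=` N s &
        forall q, closure (N s) q -> ~ N s q -> O q] /\
    (forall q, S q -> closure (N s) q -> q = s)}.
  apply: (@choice _ _ (fun s N => S s ->
    [/\ open N, D s `<=` N & forall q, closure N q -> ~ N q -> O q] /\
    (forall q, S q -> closure N q -> q = s))) => s.
  have [Ss|nS] := pselect (S s); last by exists set0.
  (* If the closure of [N s] stays in [W], it meets [U] and [V] only in [D s], which lies inside
     [N s]; its boundary is then in [O], and [s] is its only point of [S]. *)
  pose W := ~` (V `|` \bigcup_(t in S `\ s) D t).
  have oW : open W.
    apply/closed_openC/closedU => //; apply: closed_bigcup.
      exact: finite_setD.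
    by move=> t [St _]; exact: closed_disc_closed (DS t St).
  have DW : D s `<=` W.
    move=> q Dq [Vq|[t [St ts] Dt]].
      by apply: VU Vq _; rewrite UE; exists s.
    by apply: ts; apply: (tD t s) => //; exists q.
  have nW : set_nbhs (D s) W.
    by move=> q Dq; apply: open_nbhs_nbhs; split => //; exact: DW.
  have [A nA cA] := compact_normal (@rs_hausdorff R B) compactB
    (closed_disc_closed (DS s Ss)) nW.
  have cl q : closure A^° q -> W q.
    by move=> clq; apply: cA; apply: closureS clq; exact: interior_subset.
  exists A^° => _; split; first split.
  - exact: open_interior.
  - by move=> q Dq; exact: nA.
  - move=> q /cl Wq nq [|Vq]; last by apply: Wq; left.
    rewrite UE => -[t St Dt]; have [ts|ts] := pselect (t = s).
      by apply: nq; apply: nA; rewrite -ts.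
    by apply: Wq; right; exists t.
  - move=> q Sq /cl Wq; apply: contrapT => qs; apply: Wq; right.
    by exists q => //; exact: closed_disc_center (DS q Sq).
pose L := \bigcup_(s in S) (closure (N s) `&` ~` N s).
have cL : compact L.
  apply: (subclosed_compact _ compactB) => //; apply: closed_bigcup => // s Ss.
  by apply: closedI; [exact: closed_closure|apply: open_closedC; have [[]] := NP s Ss].
have LO : L `<=` O by move=> q [s Ss [cq nq]]; have [[_ _ H] _] := NP s Ss; exact: H.
pose X : set K := bounded_units S O eps.
have XP (x : K) q : X x -> O q -> [/\ x * x^-1 = 1, hol_at x q, hol_at (x^-1)%R q,
    modc (x q) <= eps^-1 & modc ((x^-1)%R q) <= eps^-1].
  move=> [xS xb] Oq; have [xV hx] := regular_unitsP xS.
  have [hxq hxVq] := hx q (SO q Oq).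
  have := hol_at_mul1 xV hxq hxVq => /(congr1 modc); rewrite modcM modc1 => E.
  have [] := xb q Oq; rewrite !modcE !rc_lt => e1 e2.
  split => //.
    rewrite -[leRHS]mul1r ler_pdivlMr// -E.
    by rewrite ler_wpM2l ?modc_ge0// ltW.
  rewrite -[leRHS]mul1r ler_pdivlMr// -E mulrC.
  by rewrite ler_wpM2r ?modc_ge0// ltW.
have Xb (x : K) : X x -> bounded_hol O eps^-1 x.
  by move=> Xx q Oq; have [] := XP x q Xx Oq.
(* On [O] the inverse of [y] is at most [eps^-1], so [x / y - 1 = (x - y) * y^-1] is at most 1/4 on
   [L]. *)
have d0 : 0 < eps / 4 by rewrite divr_gt0.
have [T [g gP]] := totally_bounded_on_compact d0 oO cL LO Xb.
have same (x y : K) : X x -> X y -> g x = g y ->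
    class_mod_constants x = class_mod_constants y.
  move=> Xx Xy gxy; have gP' := gP x y Xx Xy gxy.
  have [xV hx] := regular_unitsP Xx.1; have [yV hy] := regular_unitsP Xy.1.
  have fg : (x / y) * (y / x) = 1.
    by rewrite mulrA -(mulrA x) (mulrC y^-1) yV mulr1 xV.
  have [||||a a0 xya] := @unit_near1_const R B compactB S N (x / y) (y / x) fg.
  - move=> p pS; have [? ?] := hx p pS; have [? ?] := hy p pS.
    by split; [exact: (hol_at_mulE _ _).1|exact: (hol_at_mulE _ _).1].
  - move=> s Ss; have [[oN DN _] _] := NP s Ss.
    by split => //; apply: DN; exact: closed_disc_center (DS s Ss).
  - by move=> s q Ss Sq; have [_ H] := NP s Ss; exact: H.
  - move=> s q Ss cq nq; have Lq : L q by exists s.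
    have Oq := LO q Lq.
    have [_ hxq _ _ _] := XP x q Xx Oq.
    have [_ hyq hyVq _ yb] := XP y q Xy Oq.
    rewrite (hol_at_mulE hxq hyVq).2 -(hol_at_mul1 yV hyq hyVq) -mulrBl modcM.
    apply: le_trans (ler_pM (modc_ge0 _) (modc_ge0 _) (gP' q Lq) yb) _.
    by rewrite mulrAC divff ?gt_eqF// mul1r.
  - apply: class_mod_constants_eq a0 _.
    by rewrite -xya -mulrA (mulrC _ y) yV mulr1.
(* One representative per colour; a colour that no member has gets the default 0, which at most adds
   one element to the finite set. *)
apply: (@sub_finite_set _ _
  [set class_mod_constants (xget 0 [set x | X x /\ g x = t]) | t in [set: T]]).
  move=> _ [x Xx <-]; exists (g x) => //.
  have [Xy gy] := @xgetPex _ 0 [set x' | X x' /\ g x' = g x]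
    (ex_intro _ x (conj Xx erefl)).
  exact: same.
apply: finite_image; exact: finite_finset.
Qed.

End Finiteness.

Theorem corollary5p6 (R : realType) (B : riemannSurface R)
    (compactB : compact [set: B])
    (S : set B) (finS : finite_set S)
    (U : set B) (discsU : disjoint_discs S U)
    (V : set B) (discsV : exists2 T : set B, finite_set T & disjoint_discs T V)
    (subV : V `<=` ~` U)
    (n r : nat) (n_ge1 : (1 <= n)%N) (eps : R) (eps_gt0 : 0 < eps) :
  let B0 := ~` (U `|` V) in
  finite_set (@class_mod_constants R B @`
    [set x | bounded_units S B0 eps x /\
      exists y z : functionField B,
        [/\ y != 0, few_poles B0 r y^-1,
            linear_system (fun b => n%:Z * reduced_divisor S b) z &
            x + y = z]]).
Proof.
move=> B0; have [T finT discsT] := discsV.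
have cV := disjoint_discs_closed finT discsT.
apply: sub_finite_set (bounded_units_finite compactB finS discsU cV subV eps_gt0).
by apply: image_subset => x [].
Qed.
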